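(* Let $\mathfrak{g}$ be a finite-dimensional Lie algebra over $\Bbbk$, let $f\in\mathfrak{g}^{*}$, let $K$ be an algebraic subgroup of the automorphism group $\operatorname{Aut}\mathfrak{g}$, and let $\mathfrak{k}$ be the Lie algebra of $K$. The following conditions are equivalent: (i) $[\mathfrak{g},\mathfrak{g}^{f}]\cap\mathfrak{k}^{(f)}=\{0\}$. (ii) The linear form $f$ is $K$-stable.
   Context: $\Bbbk$ is an algebraically closed field of characteristic zero; finite-dimensional vector spaces carry the Zariski topology. For $f\in\mathfrak{g}^{*}$, $\mathfrak{g}^{f}=\{x\in\mathfrak{g}:\ f([x,y])=0\ \text{for all } y\in\mathfrak{g}\}$. $[\mathfrak{g},\mathfrak{g}^{f}]$ is the linear span of the brackets $[x,y]$ with $x\in\mathfrak{g}$, $y\in\mathfrak{g}^{f}$. The group $K$ acts on $\mathfrak{g}^{*}$ by $(\alpha.f)(x)=f(\alpha^{-1}(x))$; the differentiated action of $\mathfrak{k}$ (a Lie algebra of endomorphisms of $\mathfrak{g}$) is $(X.f)(x)=-f(X(x))$ for $X\in\mathfrak{k}$, $x\in\mathfrak{g}$. One sets $\mathfrak{k}^{(f)}=\{x\in\mathfrak{g}:\ (X.f)(x)=0\ \text{for all } X\in\mathfrak{k}\}$. A linear form $f\in\mathfrak{g}^{*}$ is called $K$-stable if there is a neighbourhood $V$ of $f$ in $\mathfrak{g}^{*}$ such that for every $g\in V$ the subspaces $\mathfrak{g}^{g}$ and $\mathfrak{g}^{f}$ are $K$-conjugate, i.e. $\mathfrak{g}^{g}=\alpha(\mathfrak{g}^{f})$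 for some $\alpha\in K$. *)

(* Defs.v *)
From HB Require Import structures.
From mathcomp Require Import all_boot all_order all_algebra.
From mathcomp Require Import mpoly.
From mathcomp Require Import boolp classical_sets.

Set Implicit Arguments.
Unset Strict Implicit.
Unset Printing Implicit Defensive.

Import GRing.Theory.
Local Open Scope ring_scope.
Local Open Scope classical_set_scope.

HB.mixin Record Vector_isLieAlgebra (k : fieldType) g of Vector k g := {
  lie : g -> g -> g;
  lie_linear_l : forall y : g, linear (lie^~ y);
  lie_linear_r : forall x : g, linear (lie x);
  lie_alt : forall x : g, lie x x = 0;
  lie_jacobi : forall x y z : g,
    lie x (lie y z) + lie y (lie z x) + lie z (lie x y) = 0
}.

#[short(type="lieAlgType")]
HB.structure Definition LieAlgebra (k : fieldType) :=
  { g of Vector k g & Vector_isLieAlgebra k g }.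

Section LinearSpan.
Variables (k : fieldType) (E : vectType k).

Definition lin_span (S : set E) : set E :=
  [set z | exists2 s : seq E, (forall x, x \in s -> S x) & z \in <<s>>%VS].

End LinearSpan.

Section Zariski.
Variables (k : fieldType) (E : vectType k).

(* Polynomial functions on E are polynomials in the coordinates with respect
   to a fixed basis. *)
Definition poly_eval (p : {mpoly k[\dim {:E}]}) (v : E) : k :=
  p.@[fun i => coord (vbasis {:E}) i v].

Definition zariski_closed (Z : set E) : Prop :=
  exists P : set {mpoly k[\dim {:E}]},
    Z = [set v | forall p, P p -> poly_eval p v = 0].

Definition zariski_open (U : set E) : Prop := zariski_closed (~` U).

Definition zariski_nbhs (v : E) (N : set E) : Prop :=
  exists U : set E, [/\ zariski_open U, U v & U `<=` N].

(* The derivative of p at v in the direction w. *)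
Definition poly_diff (p : {mpoly k[\dim {:E}]}) (v w : E) : k :=
  \sum_(i < \dim {:E}) poly_eval p^`M(i) v * coord (vbasis {:E}) i w.

(* The Zariski tangent space at v of the closure of S, as a subset of E. *)
Definition tangent_space (S : set E) (v : E) : set E :=
  [set w | forall p, (forall u, S u -> poly_eval p u = 0) ->
                     poly_diff p v w = 0].

End Zariski.

Section LieAlgebraTheory.
Variables (k : fieldType) (g : lieAlgType k).

Definition lie_aut : set 'End(g) :=
  [set a | lker a == 0%VS /\ forall x y : g, a (lie x y) = lie (a x) (a y)].

(* Aut g need not be closed in End(g), only in GL(g), so algebraic subgroups
   are cut out by polynomial equations inside Aut g. *)
Definition algebraic_subgroup (K : set 'End(g)) : Prop :=
  [/\ exists2 Z : set 'End(g), zariski_closed Z & K = lie_aut `&` Z,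
      K \1%VF,
      forall a b, K a -> K b -> K (a \o b)%VF
    & forall a, K a -> K (a^-1)%VF].

(* K is locally closed in End(g), so its tangent space at the identity is that
   of its Zariski closure. *)
Definition Lie_of (K : set 'End(g)) : set 'End(g) := tangent_space K \1%VF.

Definition coadj_stab (f : 'Hom(g, k^o)) : set g :=
  [set x | forall y, f (lie x y) = 0].

Definition bracket_span (A B : set g) : set g :=
  lin_span [set z | exists x y, [/\ A x, B y & z = lie x y]].

Definition dual_act (X : 'End(g)) (f : 'Hom(g, k^o)) : 'Hom(g, k^o) :=
  (- (f \o X))%VF.

Definition annihilated (kk : set 'End(g)) (f : 'Hom(g, k^o)) : set g :=
  [set x | forall X, kk X -> dual_act X f x = 0].

Definition K_conjugate (K : set 'End(g)) (A B : set g) : Prop :=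
  exists2 a : 'End(g), K a & A = [set a x | x in B].

Definition K_stable (K : set 'End(g)) (f : 'Hom(g, k^o)) : Prop :=
  exists2 V : set 'Hom(g, k^o), zariski_nbhs f V
    & forall h, V h -> K_conjugate K (coadj_stab h) (coadj_stab f).

End LieAlgebraTheory.

(* Main.v *)
(* Let W be the space of linear forms vanishing on [g, g^f], i.e. of the h with
   g^f contained in g^h. Condition (i) is dual to the transversality
   k.f + W = g^*. For w with g^w = g^f, the kernel of k -> g^*/W, X |-> X.w is
   the stabilizer of the subspace g^f in k; it does not depend on w, so neither
   does transversality.

   (i) => (ii). By transversality the ideal of the polynomials vanishing on K.W
   is stable under derivations, so it is zero (Taylor expansion at f, char. 0)
   and K.W is dense. Fix a complement M of g^f; where g = M + g^h is direct,
   T(h), the projection onto M along g^h, is rational in h. The set of the T(h)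
   with g^h in the K-orbit of g^f is constructible and dense among all T(h),
   hence contains those with c(T(h)) <> 0 for some polynomial c. As T(h) only
   depends on g^h, translating by an element of K moves f into this open set.

   (ii) => (i). The map from {(h, a) : a in K, g^h = a(g^f)} to g^* is dominant,
   so by generic smoothness (char. 0) every tangent vector at a generic h lifts
   to this set, which is transversality at h, hence at f.

   Constructibility and generic smoothness come from one statement: points with
   values in the dual numbers lift generically along a dominant morphism. It is
   proved by adjoining one variable at a time, with a prime ideal obtained from
   Zorn's lemma in place of irreducible components. *)
Require Import Defs.
From HB Require Import structures.
From mathcomp Require Import all_boot all_order all_algebra.
From mathcomp Require Import mpoly.
From mathcomp Require Import boolp classical_sets.
From mathcomp Require Import ring.

Set Implicit Arguments.
Unset Strict Implicit.
Unset Printing Implicit Defensive.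

Import GRing.Theory.
Local Open Scope ring_scope.
Local Open Scope classical_set_scope.

(** * Dual numbers *)

Record dual_number (R : comNzRingType) := DualNumber { dn_re : R; dn_eps : R }.

Section DualNumbers.
Variable R : comNzRingType.
Local Notation D := (dual_number R).

Definition pair_of_dn (x : D) := (dn_re x, dn_eps x).
Definition dn_of_pair (x : R * R) : D := DualNumber x.1 x.2.
Lemma pair_of_dnK : cancel pair_of_dn dn_of_pair. Proof. by case. Qed.

HB.instance Definition _ := Choice.copy D (can_type pair_of_dnK).

Lemma dnP (x y : D) : dn_re x = dn_re y -> dn_eps x = dn_eps y -> x = y.
Proof. by case: x => a b; case: y => c d /= -> ->. Qed.

Definition dn_zero := DualNumber (0 : R) 0.
Definition dn_opp (x : D) := DualNumber (- dn_re x) (- dn_eps x).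
Definition dn_add (x y : D) :=
  DualNumber (dn_re x + dn_re y) (dn_eps x + dn_eps y).

Fact dn_addA : associative dn_add.
Proof. by move=> x y z; apply: dnP; rewrite /= addrA. Qed.
Fact dn_addC : commutative dn_add.
Proof. by move=> x y; apply: dnP; rewrite /= addrC. Qed.
Fact dn_add0 : left_id dn_zero dn_add.
Proof. by move=> x; apply: dnP; rewrite /= add0r. Qed.
Fact dn_addN : left_inverse dn_zero dn_opp dn_add.
Proof. by move=> x; apply: dnP; rewrite /= addNr. Qed.

HB.instance Definition _ :=
  GRing.isZmodule.Build D dn_addA dn_addC dn_add0 dn_addN.

Definition dn_one := DualNumber (1 : R) 0.
Definition dn_mul (x y : D) :=
  DualNumber (dn_re x * dn_re y) (dn_re x * dn_eps y + dn_eps x * dn_re y).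

Fact dn_mulA : associative dn_mul.
Proof. by move=> x y z; apply: dnP; rewrite /=; ring. Qed.
Fact dn_mulC : commutative dn_mul.
Proof. by move=> x y; apply: dnP; rewrite /=; ring. Qed.
Fact dn_mul1 : left_id dn_one dn_mul.
Proof. by move=> x; apply: dnP; rewrite /=; ring. Qed.
Fact dn_mulDl : left_distributive dn_mul dn_add.
Proof. by move=> x y z; apply: dnP; rewrite /=; ring. Qed.
Fact dn_one_neq0 : dn_one != dn_zero.
Proof. by apply/eqP => -[] /eqP; rewrite oner_eq0. Qed.

HB.instance Definition _ :=
  GRing.Zmodule_isComNzRing.Build D dn_mulA dn_mulC dn_mul1 dn_mulDl dn_one_neq0.

Fact dn_re_additive : {morph @dn_re R : x y / x - y}. Proof. by []. Qed.
HB.instance Definition _ := GRing.isZmodMorphism.Build D R (@dn_re R) dn_re_additive.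
Fact dn_re_multiplicative : monoid_morphism (@dn_re R). Proof. by []. Qed.
HB.instance Definition _ := GRing.isMonoidMorphism.Build D R (@dn_re R) dn_re_multiplicative.

Fact dn_eps_additive : {morph @dn_eps R : x y / x - y}. Proof. by []. Qed.
HB.instance Definition _ := GRing.isZmodMorphism.Build D R (@dn_eps R) dn_eps_additive.

Definition dn_const (c : R) := DualNumber c 0.
Fact dn_const_additive : {morph dn_const : x y / x - y}.
Proof. by move=> x y; apply: dnP; rewrite //= subr0. Qed.
HB.instance Definition _ := GRing.isZmodMorphism.Build R D dn_const dn_const_additive.
Fact dn_const_multiplicative : monoid_morphism dn_const.
Proof. by split=> // x y; apply: dnP; rewrite //= mulr0 mul0r addr0. Qed.
HB.instance Definition _ := GRing.isMonoidMorphism.Build R D dn_const dn_const_multiplicative.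

(** First-order Taylor expansion: eps squares to zero, so only the value of the eps-part of the
    coefficients and the derivative of the real part survive. The Hensel step rests on it. *)
Lemma horner_dn (P : {poly D}) (a b : R) :
  P.[DualNumber a b] =
  DualNumber (map_poly (@dn_re R) P).[a]
    ((map_poly (@dn_eps R) P).[a] + b * (map_poly (@dn_re R) P)^`().[a]).
Proof.
elim/poly_ind: P => [|P c IH].
  by rewrite !map_poly0 deriv0 !horner0 mulr0 addr0.
apply: dnP.
  by rewrite hornerMXaddC rmorphD rmorphM /= IH /= rmorphD rmorphM /=
    map_polyX map_polyC hornerMXaddC.
have epsE : map_poly (@dn_eps R) (P * 'X + c%:P)
          = map_poly (@dn_eps R) P * 'X + (dn_eps c)%:P.
  by rewrite raddfD /= map_polyC; congr (_ + _); apply/polyP => i;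
    rewrite coef_map coefMX coefMX; case: i => [|i] /=; rewrite ?raddf0 ?coef_map.
rewrite hornerMXaddC raddfD /= IH epsE /= hornerMXaddC.
rewrite rmorphD rmorphM /= map_polyX map_polyC.
by rewrite derivD derivC addr0 derivM derivX mulr1 hornerD hornerMX; ring.
Qed.

Lemma horner_dn_re (P : {poly D}) (z : D) :
  dn_re P.[z] = (map_poly (@dn_re R) P).[dn_re z].
Proof. by case: z => a b; rewrite horner_dn. Qed.

End DualNumbers.

(** A dual number with nonzero real part is a unit, since its eps-part is nilpotent; this is stated
    as cancellation. *)
Lemma dn_re_unit (k : fieldType) (x y : dual_number k) :
  dn_re x != 0 -> x * y = 0 -> y = 0.
Proof.
case: x => a b; case: y => c d /= a0 [] /eqP.
rewrite mulf_eq0 (negbTE a0) /= => /eqP ->; rewrite mulr0 addr0 => /eqP.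
by rewrite mulf_eq0 (negbTE a0) /= => /eqP ->.
Qed.

(** * Prime ideals and generic lifting *)

Definition is_ideal (B : comNzRingType) (J : set B) :=
  [/\ J 0, forall x y, J x -> J y -> J (x + y) & forall x y, J y -> J (x * y)].

Definition is_prime (B : comNzRingType) (P : set B) :=
  [/\ is_ideal P, ~ P 1 & forall x y, P (x * y) -> P x \/ P y].

Section PrimeTheory.
Variables (B : comNzRingType) (P : set B).

Lemma ideal_sum (I : Type) (r : seq I) (F : I -> B) :
  is_ideal P -> (forall i, P (F i)) -> P (\sum_(i <- r) F i).
Proof. by case=> P0 PD _ PF; apply: (big_ind P). Qed.

Lemma ideal_opp x : is_ideal P -> P x -> P (- x).
Proof. by case=> _ _ PM Px; rewrite -mulN1r; apply: PM. Qed.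

Lemma ideal_sub x y : is_ideal P -> P x -> P y -> P (x - y).
Proof. by move=> idP Px /(ideal_opp idP) Py; case: idP => _ PD _; apply: PD. Qed.

Lemma ideal_mulr x y : is_ideal P -> P x -> P (x * y).
Proof. by case=> _ _ PM Px; rewrite mulrC; apply: PM. Qed.

Lemma prime_exp x n : is_prime P -> P (x ^+ n) -> P x.
Proof.
by case=> _ P1 PM; elim: n => [|n IH]; rewrite ?expr0 // exprS => /PM[].
Qed.

Lemma prime_preimage (C : comNzRingType) (f : {rmorphism C -> B}) :
  is_prime P -> is_prime (f @^-1` P).
Proof.
case=> -[P0 PD PM] P1 Pprime; split; [split|..] => /=.
- by rewrite rmorph0.
- by move=> x y Px Py; rewrite rmorphD; apply: PD.
- by move=> x y Py; rewrite rmorphM; apply: PM.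
- by rewrite rmorph1.
- by move=> x y; rewrite rmorphM => /Pprime.
Qed.

End PrimeTheory.

(** An ideal maximal among those that contain [J] and miss the multiplicative set [S] is prime;
    Zorn's lemma provides one. *)
Lemma prime_avoiding (B : comNzRingType) (J S : set B) :
  is_ideal J -> S 1 -> (forall x y, S x -> S y -> S (x * y)) ->
  (forall x, J x -> ~ S x) ->
  exists P, [/\ is_prime P, J `<=` P & forall x, P x -> ~ S x].
Proof.
move=> idJ S1 SM JS.
pose good (I : set B) := [/\ is_ideal I, J `<=` I & forall x, I x -> ~ S x].
(* [Zorn_bigcup] also ranges over the empty chain, hence the case [I = set0]. *)
have [|A [goodA maxA]] := @Zorn_bigcup B [set I | I = set0 \/ good I].
  move=> F Fgood Ftot /=.
  have [[I0 [FI0 goodI0]]|noI] := pselect (exists I, F I /\ good I); last first.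
    left; apply/seteqP; split=> // x [I FI Ix]; case: (Fgood _ FI) => [I0|gI].
      by rewrite I0 in Ix.
    by case: noI; exists I.
  have inI0 I x : F I -> I x -> exists I', [/\ F I', good I' & I' x].
    move=> FI Ix; exists I; split=> //; case: (Fgood _ FI) => // I0'.
    by rewrite I0' in Ix.
  right; split.
  - split.
    + by exists I0 => //; case: goodI0 => -[].
    + move=> x y [I1 F1 x1] [I2 F2 y2].
      have [I1' [F1' g1 x1']] := inI0 _ _ F1 x1.
      have [I2' [F2' g2 y2']] := inI0 _ _ F2 y2.
      case: (Ftot _ _ F1' F2') => sub.
        by exists I2' => //; case: g2 => -[_ D _] _ _; apply: D => //; apply: sub.
      by exists I1' => //; case: g1 => -[_ D _] _ _; apply: D => //; apply: sub.
    + move=> x y [I1 F1 y1]; have [I1' [F1' g1 y1']] := inI0 _ _ F1 y1.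
      by exists I1' => //; case: g1 => -[_ _ M] _ _; apply: M.
  - by move=> x Jx; exists I0 => //; case: goodI0 => _ sub _; apply: sub.
  - move=> x [I1 F1 x1]; have [I1' [F1' g1 x1']] := inI0 _ _ F1 x1.
    by case: g1 => _ _; apply.
have goodJ : good J by split.
have {}goodA : good A.
  case: goodA => // A0; case: (maxA J); last by right.
  rewrite A0; split=> // JA; case: idJ => J0 _ _; exact: (JA 0).
case: (goodA) => idA JA AS; case: (idA) => A0 AD AM.
exists A; split=> //; split=> // [A1|x y Axy]; first exact: AS A1 S1.
(* If neither factor is in A, both ideals A + (x) and A + (y) meet S. *)
have meets z : ~ A z -> exists a c, A a /\ S (a + c * z).
  move=> nAz; apply: contrapT => noS.
  apply: (maxA [set b | exists a c, A a /\ b = a + c * z]).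
    split=> [b Ab|sub]; first by exists b, 0; rewrite mul0r addr0.
    by apply: nAz; apply: sub; exists 0, 1; rewrite add0r mul1r.
  right; split; first split.
  - by exists 0, 0; rewrite mul0r addr0.
  - move=> _ _ [a [c [Aa ->]]] [a' [c' [Aa' ->]]]; exists (a + a'), (c + c').
    by split; [apply: AD|ring].
  - move=> b _ [a [c [Aa ->]]]; exists (b * a), (b * c).
    by split; [apply: AM|ring].
  - by move=> b /JA Ab; exists b, 0; rewrite mul0r addr0.
  - by move=> _ [a [c [Aa ->]]] Sb; apply: noS; exists a, c.
have [|nAx] := pselect (A x); first by left.
have [|nAy] := pselect (A y); first by right.
have [a [c [Aa Sa]]] := meets _ nAx; have [b [d [Ab Sb]]] := meets _ nAy.
case: (AS _ _ (SM _ _ Sa Sb)).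
have -> : (a + c * x) * (b + d * y)
  = (b + d * y) * a + ((c * x) * b + (c * d) * (x * y)) by ring.
by apply: (AD); [exact: AM|apply: (AD); exact: AM].
Qed.

(** Each step cancels the leading term of [G] at the cost of one more factor [lead_coef E]. The
    bound on [Q] makes the quotient by a nonconstant [E] shorter than a nonzero dividend. *)
Lemma pseudo_division (R : comNzRingType) (E G : {poly R}) :
  E != 0 -> exists s Q F,
    [/\ lead_coef E ^+ s *: G = Q * E + F, (size F < size E)%N
      & (size Q <= (size G).+1 - size E)%N].
Proof.
move=> E0; have [n] := ubnP (size G); elim: n G => // n IH G leG.
have [ltGE|leEG] := ltnP (size G) (size E).
  by exists 0%N, 0, G; rewrite scale1r mul0r add0r size_poly0.
pose m := (size G - size E)%N.
have sE : (0 < size E)%N by rewrite size_poly_gt0.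
pose G1 := lead_coef E *: G - lead_coef G *: (E * 'X^m).
have sG : (0 < size G)%N := leq_trans sE leEG.
have mE : (m + (size E).-1)%N = (size G).-1.
  by rewrite -subn1 addnBA // subnK // subn1.
have ltG1 : (size G1 < size G)%N.
  rewrite -[X in (_ < X)%N](prednK sG) ltnS; apply/leq_sizeP => j lej.
  rewrite coefB !coefZ coefMXn.
  have [->|ltj] := eqVneq j (size G).-1.
    rewrite ltnNge -mE leq_addr /= addKn mE -!lead_coefE.
    by rewrite mulrC subrr.
  have ltj' : ((size G).-1 < j)%N by rewrite ltn_neqAle eq_sym ltj.
  rewrite (nth_default 0); last by rewrite -(prednK sG).
  rewrite mulr0 sub0r; case: ifP => _; rewrite ?mulr0 ?oppr0 //.
  rewrite nth_default ?mulr0 ?oppr0 //.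
  by rewrite -(prednK sE) ltn_subRL mE.
have [|s [Q [F [eqG1 ltF leQ]]]] := IH G1; first exact: leq_trans ltG1 _.
exists s.+1, ((lead_coef E ^+ s * lead_coef G) *: 'X^m + Q), F; split=> //.
  rewrite exprSr -scalerA -(subrK (lead_coef G *: (E * 'X^m)) (_ *: G)).
  rewrite -/G1 scalerDr eqG1 mulrDl -!scalerAl scalerA ['X^m * E]mulrC.
  by rewrite addrC addrA.
apply: leq_trans (size_polyD _ _) _; rewrite geq_max; apply/andP; split.
  apply: leq_trans (size_scale_leq _ _) _.
  by rewrite size_polyXn subSn.
by apply: leq_trans leQ _; rewrite leq_sub2r // ltnW.
Qed.

Lemma minimal_element (T : Type) (m : T -> nat) (Q : T -> Prop) :
  (exists x, Q x) -> exists x, Q x /\ forall y, Q y -> (m x <= m y)%N.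
Proof.
move=> [x0 Qx0]; pose S n := `[< exists x, Q x /\ m x = n >].
have exS : exists n, S n by exists (m x0); apply/asboolP; exists x0.
case: (ex_minnP exS) => n /asboolP[x [Qx <-]] minx.
by exists x; split=> // y Qy; apply: minx; apply/asboolP; exists y.
Qed.

(** * Primes of R[X] and their elements of least degree *)

Section MinimalPolynomial.
Variables (R : comNzRingType) (P : set {poly R}).
Hypothesis primeP : is_prime P.

Let idP : is_ideal P. Proof. by case: primeP. Qed.

(** This is vanishing in (R/p)[X], where p is the contraction of [P] to R. It allows computing
    modulo p, and over the fraction field of R/p, without forming either ring. *)
Definition coefs_in (F : {poly R}) := forall i, P (F`_i)%:P.

Lemma coefs_in_mem F : coefs_in F -> P F.
Proof.
move=> smallF; rewrite -[F]coefK poly_def; apply: ideal_sum => // i.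
by rewrite -mul_polyC; apply: ideal_mulr.
Qed.

Lemma coefs_in0 : coefs_in 0.
Proof. by move=> i; rewrite coef0 polyC0; case: idP. Qed.

Lemma coefs_inD F G : coefs_in F -> coefs_in G -> coefs_in (F + G).
Proof.
by case: idP => _ PD _ sF sG i; rewrite coefD polyCD; apply: PD.
Qed.

Lemma coefs_inM F G : coefs_in G -> coefs_in (F * G).
Proof.
move=> sG i; rewrite coefM rmorph_sum /=; apply: ideal_sum => // j.
by rewrite polyCM; case: idP => _ _; apply.
Qed.

Lemma coefs_in_reduce F : ~ coefs_in F ->
  exists F', [/\ coefs_in (F - F')%R, ~ P (lead_coef F')%:P
               & (size F' <= size F)%N].
Proof.
have [n] := ubnP (size F); elim: n F => // n IH F leF nsF.
have [PF|nPF] := pselect (P (lead_coef F)%:P); last first.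
  by exists F; split=> //; rewrite subrr; apply: coefs_in0.
have F0 : F != 0 by apply: contra_notN nsF => /eqP ->; apply: coefs_in0.
pose T : {poly R} := lead_coef F *: 'X^((size F).-1).
have sT : coefs_in T.
  move=> i; rewrite /T coefZ polyCM; exact: ideal_mulr.
have ltF : (size (F - T)%R < size F)%N.
  rewrite -[X in (_ < X)%N]prednK ?size_poly_gt0 // ltnS.
  apply/leq_sizeP => j lej; rewrite coefB coefZ coefXn.
  have [->|ltj] := eqVneq j (size F).-1; first by rewrite mulr1 subrr.
  rewrite mulr0 subr0 nth_default //.
  rewrite -[X in (X <= _)%N]prednK ?size_poly_gt0 //.
  by rewrite ltn_neqAle eq_sym ltj.
have [||F' [sF' nF' leF']] := IH (F - T).
- exact: leq_trans ltF _.
- by move=> sFT; apply: nsF; rewrite -(subrK T F); apply: coefs_inD.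
exists F'; split=> //; last exact: leq_trans leF' (ltnW ltF).
have -> : F - F' = (F - T - F') + T by ring.
exact: coefs_inD.
Qed.

Variable P0 : {poly R}.
Hypothesis leadP0 : ~ P (lead_coef P0)%:P.
Hypothesis P_P0 : P P0.
Hypothesis minP0 : forall F, P F -> (size F < size P0)%N -> coefs_in F.

Lemma minimal_polynomial_size : (1 < size P0)%N.
Proof.
rewrite ltnNge; apply/negP => /size1_polyC P0C.
by apply: leadP0; rewrite P0C lead_coefC -P0C.
Qed.

(** Over the fraction field of R/p, p being the contraction of [P], the polynomial [P0] generates
    the prime extending [P], so [G] outside [P] is coprime to it. Clearing denominators leaves a
    constant [c] outside [P] and an error [w] with coefficients in [P]. *)
Lemma minimal_polynomial_bezout G : ~ P G ->
  exists u v w c, [/\ u * G + v * P0 + w = c%:P, coefs_in w & ~ P c%:P].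
Proof.
case: primeP => _ _ PM nPG.
(* The ideal generated by [G] and [P0], modulo polynomials with coefficients in [P]; an element [E]
   of least degree plays the role of a gcd. *)
pose comb E := exists u v, coefs_in (E - (u * G + v * P0)).
have combG : comb G.
  by exists 1, 0; rewrite mul1r mul0r addr0 subrr; apply: coefs_in0.
have comb_reduce F : comb F -> ~ coefs_in F -> exists F',
    [/\ comb F', ~ P (lead_coef F')%:P & (size F' <= size F)%N].
  move=> [u [v sF]] /coefs_in_reduce[F' [sF' nF' leF']].
  exists F'; split=> //; exists u, v.
  have -> : F' - (u * G + v * P0) = -1 * (F - F') + (F - (u * G + v * P0)).
    by ring.
  by apply: coefs_inD => //; apply: coefs_inM.
have [|E [[combE leadE] minE]] := @minimal_element _ (fun E : {poly R} => size E)
    (fun E => comb E /\ ~ P (lead_coef E)%:P).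
  have [|E [cE lE _]] := comb_reduce G combG; last by exists E.
  by move/coefs_in_mem.
have small F : comb F -> (size F < size E)%N -> coefs_in F.
  move=> cF ltF; apply: contrapT => /(comb_reduce _ cF)[F' [cF' lF' leF']].
  by have := minE F' (conj cF' lF'); rewrite leqNgt (leq_ltn_trans leF' ltF).
have [le1|lt1] := leqP (size E) 1.
  case: combE => u [v sE]; exists u, v, (E - (u * G + v * P0)), E`_0.
  split=> //; first by rewrite addrC subrK -size1_polyC.
  by rewrite [E`_0](_ : _ = lead_coef E) // lead_coefE; case: (size E) le1 => [|[]].
have E0 : E != 0 by rewrite -size_poly_gt0 ltnW.
case: combE => u [v sE].
have comb_rem F s Q Rm : comb F -> lead_coef E ^+ s *: F = Q * E + Rm -> comb Rm.
  move=> [u' [v' sF]] eqF.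
  exists ((lead_coef E ^+ s)%:P * u' - Q * u),
         ((lead_coef E ^+ s)%:P * v' - Q * v).
  have -> : Rm - (((lead_coef E ^+ s)%:P * u' - Q * u) * G
               + ((lead_coef E ^+ s)%:P * v' - Q * v) * P0)
    = (lead_coef E ^+ s)%:P * (F - (u' * G + v' * P0))
      + (- Q) * (E - (u * G + v * P0)).
    have -> : Rm = (lead_coef E ^+ s)%:P * F - Q * E.
      by rewrite mul_polyC eqF addrC addKr.
    by ring.
  by apply: coefs_inD; apply: coefs_inM.
have combP0 : comb P0.
  by exists 0, 1; rewrite mul1r mul0r add0r subrr; apply: coefs_in0.
(* A nonconstant [E] divides [G] and [P0] up to powers of its leading coefficient and remainders
   with coefficients in [P]. If [E] is in [P], so is [G]. Otherwise the cofactor of [E] in [P0] is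
   in [P] and shorter than [P0], which puts the leading coefficient of [P0] in [P]. *)
exfalso; have [PE|nPE] := pselect (P E).
  have [s [Q [Rm [eqG ltR _]]]] := pseudo_division G E0.
  have sR := small _ (comb_rem _ _ _ _ combG eqG) ltR.
  have: P (lead_coef E ^+ s *: G).
    rewrite eqG; case: idP => _ PD PMl; apply: PD; first exact: PMl.
    exact: coefs_in_mem.
  by rewrite -mul_polyC => /PM[]//; rewrite rmorphXn => /(prime_exp primeP).
have [s [Q [Rm [eqP0 ltR leQ]]]] := pseudo_division P0 E0.
have sR := small _ (comb_rem _ _ _ _ combP0 eqP0) ltR.
have: P (Q * E).
  have -> : Q * E = lead_coef E ^+ s *: P0 - Rm by rewrite eqP0 addrK.
  apply: ideal_sub => //; last exact: coefs_in_mem.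
  by rewrite -mul_polyC; case: idP => _ _; apply.
case/PM=> // PQ.
have sQ : coefs_in Q.
  apply: minP0 => //; apply: leq_ltn_trans leQ _.
  apply: (leq_ltn_trans (leq_sub2l _ lt1)); rewrite subSS subn1 ltn_predL.
  exact: ltnW minimal_polynomial_size.
have /(_ (size P0).-1) : coefs_in (lead_coef E ^+ s *: P0).
  by rewrite eqP0 mulrC; apply: coefs_inD => //; apply: coefs_inM.
rewrite coefZ -lead_coefE rmorphM rmorphXn => /PM[]//.
by move/(prime_exp primeP).
Qed.

End MinimalPolynomial.

(** * Generic lifting along one adjoined variable *)

Section Extension.
Variables (k : closedFieldType) (char0 : [pchar k] =i pred0).
Local Notation D := (dual_number k).

(* Dominance with generic smoothness: over the open set defined by [a],
   points and tangent vectors (i.e. points over the dual numbers) of the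
   subvariety defined by the contraction of [P] lift to that defined by [P]. *)
Definition lifts_generically (A B : comNzRingType) (i : {rmorphism A -> B}) :=
  forall (P : set B) b, is_prime P -> ~ P b ->
  exists a, ~ P (i a) /\ forall Phi : {rmorphism A -> D},
    (forall x, P (i x) -> Phi x = 0) -> dn_re (Phi a) != 0 ->
  exists Psi : {rmorphism B -> D}, [/\ forall x, Psi (i x) = Phi x,
    forall x, P x -> Psi x = 0 & dn_re (Psi b) != 0].

(** Either X is transcendental over the contraction of [P], and any value of X at which [b] does not
    vanish will do, or X is algebraic with minimal polynomial [P0], separable in characteristic 0,
    and a simple root of [P0] lifts to the dual numbers. *)
Lemma lifts_generically_polyC (R : comNzRingType) :
  lifts_generically (@polyC R).
Proof.
move=> P b primeP nPb; case: (primeP) => idP _ PM.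
pose ev (Phi : {rmorphism R -> D}) z : {rmorphism {poly R} -> D} :=
  horner_morph (fun r => mulrC z (Phi r)).
have evE Phi z F : ev Phi z F = (map_poly Phi F).[z] by [].
have evC Phi z r : ev Phi z r%:P = Phi r by rewrite evE map_polyC hornerC.
pose red (Phi : {rmorphism R -> D}) F : {poly k} :=
  map_poly (@dn_re k) (map_poly Phi F).
have redE Phi F i : (red Phi F)`_i = dn_re (Phi F`_i) by rewrite !coef_map.
have ev_re Phi z F : dn_re (ev Phi z F) = (red Phi F).[dn_re z].
  by rewrite evE horner_dn_re.
have ev_small (Phi : {rmorphism R -> D}) z F : (forall x, P x%:P -> Phi x = 0) -> coefs_in P F ->
    ev Phi z F = 0.
  move=> kill sF; rewrite evE (_ : map_poly Phi F = 0) ?horner0 //.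
  by apply/polyP => i; rewrite coef_map coef0 /= kill //; apply: sF.
have [allsmall|nall] := pselect (forall F, P F -> coefs_in P F).
  have [i nPi] : exists i, ~ P (b`_i)%:P.
    by apply/existsNP => small_b; apply: nPb; apply: coefs_in_mem.
  exists b`_i; split=> // Phi kill nz.
  have : red Phi b != 0.
    by apply: contraNneq nz => red0; rewrite -redE red0 coef0.
  move/closed_nonrootP => [x nroot]; exists (ev Phi (DualNumber x 0)).
  split; first exact: evC; last by rewrite ev_re.
  by move=> F PF; apply: ev_small => //; apply: allsmall.
have [|P0 [[PP0 leadP0] minP0']] := @minimal_element _
    (fun F : {poly R} => size F) (fun F => P F /\ ~ P (lead_coef F)%:P).
  move/existsNP : nall => [F /not_implyP[PF /coefs_in_reduce]].
  move=> /(_ primeP)[F' [sF' nF' _]]; exists F'; split=> //.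
  rewrite -(subKr F F'); apply: ideal_sub => //.
  exact: coefs_in_mem.
have minP0 F : P F -> (size F < size P0)%N -> coefs_in P F.
  move=> PF ltF; apply: contrapT => /(coefs_in_reduce primeP)[F' [sF' nF' leF']].
  have PF' : P F'.
    by rewrite -(subKr F F'); apply: ideal_sub => //; apply: coefs_in_mem.
  by have := minP0' F' (conj PF' nF'); rewrite leqNgt (leq_ltn_trans leF' ltF).
have size_P0 : (1 < size P0)%N := minimal_polynomial_size leadP0 PP0.
have P0_neq0 : P0 != 0 by rewrite -size_poly_gt0 ltnW.
set l := lead_coef P0 in leadP0.
pose n := (size P0).-1.
have n_gt0 : (0 < n)%N by rewrite /n; case: (size P0) size_P0 => [|[]].
(* If [n] lies in [P], then [Phi] would kill a nonzero integer; there is no such [Phi] and [a = 1]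
   works. *)
have [Pn|nPn] := pselect (P (n%:R)%:P).
  exists 1; split; first by case: primeP.
  move=> Phi kill _; have /(congr1 (@dn_re k)) := kill _ Pn.
  rewrite rmorph_nat rmorph_nat raddf0 => /eqP.
  by move/pcharf0P: char0 => ->; rewrite eqn0Ngt n_gt0.
have nP' : ~ P P0^`().
  move=> P'; have := minP0 _ P' (lt_size_deriv P0_neq0) n.-1.
  rewrite coef_deriv prednK // -lead_coefE -mulr_natr polyCM.
  by case/PM.
(* Bezout is applied to the product, so that where [c] does not vanish, neither [b] nor the
   derivative of [P0] vanishes at a root of [P0]. *)
have nPbP' : ~ P (b * P0^`()) by case/PM.
have [u [v [w [c [bez sw nPc]]]]] :=
  minimal_polynomial_bezout primeP leadP0 PP0 minP0 nPbP'.
exists (l * c); split; first by rewrite rmorphM => /PM[].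
move=> Phi kill; rewrite rmorphM rmorphM /= mulf_eq0 negb_or => /andP[nzl nzc].
(* The coefficient of index [n > 0] survives under [Phi], so the reduction of [P0] is not constant
   and has a root. *)
have : size (red Phi P0) != 1%N.
  apply/eqP => /eqP s1; move: nzl; rewrite -redE nth_default ?eqxx //.
  by rewrite (eqP s1).
move/closed_rootP => [x /rootP rootx].
have bezx : (red Phi b).[x] * (red Phi P0)^`().[x] != 0.
  move/(congr1 (ev Phi (DualNumber x 0))): bez.
  rewrite rmorphD (ev_small _ _ w) // addr0 evC => /(congr1 (@dn_re k)).
  rewrite !rmorphD !rmorphM /= !ev_re rootx mulr0 addr0 => bez.
  have : (red Phi u).[x] * ((red Phi b).[x] * (red Phi P0^`()).[x]) != 0.
    by rewrite bez.
  by rewrite mulf_eq0 negb_or => /andP[_]; rewrite /red !deriv_map.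
move: bezx; rewrite mulf_eq0 negb_or => /andP[nzb nzP'].
(* One Hensel step lifts the simple root [x] to the dual numbers. *)
pose z := DualNumber x
  (- (map_poly (@dn_eps k) (map_poly Phi P0)).[x] / (red Phi P0)^`().[x]).
have evP0 : ev Phi z P0 = 0.
  by rewrite evE horner_dn -/(red _ _) rootx mulrVK ?unitfE // addrN.
exists (ev Phi z); split; [exact: evC| |by rewrite ev_re].
(* Up to a power of [l], an element of [P] is a multiple of [P0] plus a remainder with coefficients
   in [P]; both are killed, and [l] is invertible at [Phi]. *)
move=> F PF; have [s [Q [Rm [eqF ltR _]]]] := pseudo_division F P0_neq0.
have sR : coefs_in P Rm.
  apply: minP0 => //; have -> : Rm = (l ^+ s)%:P * F - Q * P0.
    by rewrite mul_polyC eqF addrC addKr.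
  by apply: ideal_sub => //; case: idP => _ _; apply.
have nzls : dn_re (Phi (l ^+ s)) != 0 by rewrite rmorphXn rmorphXn expf_neq0.
apply: (dn_re_unit nzls).
by rewrite -(evC Phi z) -rmorphM mul_polyC eqF rmorphD rmorphM evP0 mulr0 add0r
  ev_small.
Qed.

End Extension.

Lemma mpoly_rmorphism_eq n (R S : comNzRingType)
    (F G : {rmorphism {mpoly R[n]} -> S}) :
  (forall c, F c%:MP = G c%:MP) -> (forall i, F 'X_i = G 'X_i) -> F =1 G.
Proof.
move=> eqC eqX p; rewrite [p]mpolyE !rmorph_sum /=; apply: eq_bigr => m _.
rewrite -mul_mpolyC !rmorphM eqC mpolyXE_id !rmorph_prod; congr (_ * _).
by apply: eq_bigr => i _; rewrite !rmorphXn /= eqX.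
Qed.

(** * Generic lifting along several variables *)

Section MultivariateExtension.
Variables (k : closedFieldType) (char0 : [pchar k] =i pred0).
Local Notation D := (dual_number k).

(** Induction on the number of variables: [join] and [split] translate between [N.+1] variables and
    one variable over the first [N], and two generic lifts are composed. *)
Lemma lifts_generically_mpolyC (A : comNzRingType) N :
  lifts_generically k (@mpolyC N A).
Proof.
elim: N => [|N IH] P b primeP nPb.
  have constE (p : {mpoly A[0]}) : p = (p@_0%MM)%:MP.
    apply/mpolyP => m; rewrite mcoeffC (_ : m = 0%MM) ?eqxx ?mulr1 //.
    by apply/mnmP => -[].
  exists b@_0%MM; split=> [|Phi kill nz]; first by rewrite /= -constE.
  exists (mmap Phi (fun=> 0)); split=> [x|x Px|] /=.
  - by rewrite mmapC.
  - by rewrite [x]constE mmapC; apply: kill; rewrite /= -constE.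
  - by rewrite [b]constE mmapC.
pose join : {rmorphism {poly {mpoly A[N]}} -> {mpoly A[N.+1]}} :=
  horner_morph (fun p : {mpoly A[N]} => mulrC 'X_ord_max
    (mmap (@mpolyC N.+1 A) (fun j => 'X_(lift ord_max j)) p)).
pose split : {rmorphism {mpoly A[N.+1]} -> {poly {mpoly A[N]}}} :=
  mmap (polyC \o @mpolyC N A)
    (fun i => if unlift ord_max i is Some j then ('X_j)%:P else 'X).
have joinC p : join p%:P = mmap (@mpolyC N.+1 A) (fun j => 'X_(lift ord_max j)) p.
  by rewrite /join /= /horner_morph map_polyC hornerC.
have splitC c : split c%:MP = (c%:MP)%:P by rewrite /split /= mmapC.
have splitK p : join (split p) = p.
  apply: (mpoly_rmorphism_eq (F := join \o split) (G := idfun)) => [c|i] /=.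
    by rewrite splitC joinC mmapC.
  rewrite /split /= mmapX mmap1U; case: unliftP => [j ->|->].
    by rewrite joinC mmapX mmap1U.
  by rewrite /join /= /horner_morph map_polyX hornerX.
have nPb' : ~ (join @^-1` P) (split b) by rewrite /= splitK.
have primeP' := prime_preimage join primeP.
have [a1 [nPa1 lift1]] := lifts_generically_polyC char0 primeP' nPb'.
have [a [nPa lift0]] := IH _ _ (prime_preimage (@polyC _) primeP') nPa1.
have jC c : join (c%:MP)%:P = c%:MP by rewrite joinC mmapC.
exists a; split; first by move: nPa; rewrite /= jC.
move=> Phi kill nz; have [|Psi0 [Psi0C Psi0P nz0]] := lift0 Phi _ nz.
  by move=> x /=; rewrite jC; apply: kill.
have [|Psi1 [Psi1C Psi1P nz1]] := lift1 Psi0 _ nz0; first by move=> x; apply: Psi0P.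
exists (Psi1 \o split); split=> [x|x Px|] //=.
- by rewrite splitC Psi1C Psi0C.
- by apply: Psi1P; rewrite /= splitK.
Qed.

(* The second hypothesis says that the set of the points [phi i] of Spec A has
   an irreducible closure. *)
Lemma dominant_lift (A : comNzRingType) N (I : Type)
    (phi : I -> {rmorphism A -> k}) (x : I -> 'I_N -> k) (b : {mpoly A[N]}) :
  inhabited I ->
  (forall a a', (exists i, phi i a != 0) -> (exists i, phi i a' != 0) ->
     exists i, phi i (a * a') != 0) ->
  (forall i, mmap (phi i) (x i) b != 0) ->
  exists a, (exists i, phi i a != 0) /\
    forall Phi : {rmorphism A -> D},
      (forall a', (forall i, phi i a' = 0) -> Phi a' = 0) ->
      dn_re (Phi a) != 0 ->
    exists z : 'I_N -> D,
      (forall p, (forall i, mmap (phi i) (x i) p = 0) -> mmap Phi z p = 0)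
      /\ dn_re (mmap Phi z b) != 0.
Proof.
move=> [i0] irred nzb.
pose ev i : {rmorphism {mpoly A[N]} -> k} := mmap (phi i) (x i).
pose J : set {mpoly A[N]} := [set p | forall i, ev i p = 0].
(* A prime containing [J] and missing [S] stands for a component of the closure of the family that
   dominates the base and on which [b] is not identically zero. *)
pose S : set {mpoly A[N]} :=
  [set p | exists a n, (exists i, phi i a != 0) /\ p = a%:MP * b ^+ n].
have evC i a : ev i a%:MP = phi i a by rewrite /ev /= mmapC.
have idJ : is_ideal J.
  split=> [i|p q Jp Jq i|p q Jq i]; first by rewrite rmorph0.
    by rewrite rmorphD Jp Jq addr0.
  by rewrite rmorphM Jq mulr0.
have S1 : S 1.
  by exists 1, 0%N; rewrite mulr1 mpolyC1; split=> //; exists i0; rewrite rmorph1 oner_neq0.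
have SM p q : S p -> S q -> S (p * q).
  move=> [a [n [nza ->]]] [a' [n' [nza' ->]]]; exists (a * a'), (n + n')%N.
  by split; [apply: irred|rewrite rmorphM exprD /= mulrACA].
have JS p : J p -> ~ S p.
  move=> Jp [a [n [[i nza] eqp]]]; have := Jp i; rewrite eqp rmorphM evC rmorphXn.
  by move/eqP; rewrite mulf_eq0 (negbTE nza) expf_eq0 (negbTE (nzb i)) andbF.
have [P [primeP JP PS]] := prime_avoiding idJ S1 SM JS.
have nPb : ~ P b.
  move=> /PS; apply; exists 1, 1%N; rewrite expr1 mpolyC1 mul1r; split=> //.
  by exists i0; rewrite rmorph1 oner_neq0.
have [a [nPa lift]] := lifts_generically_mpolyC primeP nPb.
exists a; split.
  apply: contrapT => /forallNP alla; apply: nPa; apply: JP => i.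
  by rewrite evC; apply/eqP; apply: contrapT => /negP; apply: alla.
(* An element of the contraction of [P] vanishes at every [phi i], since otherwise it would belong
   to [S]. *)
move=> Phi kill nz; have [a' Pa'|Psi [PsiC PsiP nzb']] := lift Phi _ nz.
  apply: kill => i; apply/eqP; apply: contrapT => /negP nza'.
  apply: (PS _ Pa'); exists a', 0%N; rewrite expr0 mulr1; split=> //.
  by exists i.
have PsiE : Psi =1 mmap Phi (fun i => Psi 'X_i).
  apply: mpoly_rmorphism_eq => [c|i] /=; first by rewrite PsiC mmapC.
  by rewrite mmapX mmap1U.
exists (fun i => Psi 'X_i); split=> [p allp|]; rewrite -PsiE //.
exact/PsiP/JP.
Qed.

End MultivariateExtension.

(** * Polynomial functions on vector spaces *)

Section PolynomialFunctions.
Variable k : closedFieldType.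

Lemma poly_eq_of_horner (p q d : {poly k}) :
  d != 0 -> (forall t, d.[t] != 0 -> p.[t] = q.[t]) -> p = q.
Proof.
move=> d0 eqpq; apply/eqP; rewrite -subr_eq0; apply/negPn/negP => pq0.
have /closed_nonrootP[t] : (p - q) * d != 0 by rewrite mulf_neq0.
rewrite rootM negb_or !rootE hornerD hornerN => /andP[] + dt.
by rewrite (eqpq _ dt) subrr eqxx.
Qed.

Lemma poly_eq_of_horner_all (p q : {poly k}) :
  (forall t, p.[t] = q.[t]) -> p = q.
Proof. by move=> eqpq; apply: (poly_eq_of_horner (oner_neq0 _)). Qed.

Lemma mpoly_ring_ind n (R : comNzRingType) (Q : {mpoly R[n]} -> Prop) :
  (forall c, Q c%:MP) -> (forall i, Q 'X_i) ->
  (forall p q, Q p -> Q q -> Q (p + q)) ->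
  (forall p q, Q p -> Q q -> Q (p * q)) -> forall p, Q p.
Proof.
move=> QC QX QD QM p; rewrite [p]mpolyE; apply: (big_ind Q) => //.
  by rewrite -mpolyC0.
move=> m _; rewrite -mul_mpolyC; apply: (QM) => //; rewrite mpolyXE_id.
apply: (big_ind Q) => //; first by rewrite -mpolyC1.
move=> i _; elim: (m i) => [|j IH]; first by rewrite expr0 -mpolyC1.
by rewrite exprS; apply: QM.
Qed.

Lemma deriv_mmap n (h : 'I_n -> {poly k}) (p : {mpoly k[n]}) :
  (mmap (@polyC k) h p)^`() = \sum_i mmap (@polyC k) h p^`M(i) * (h i)^`().
Proof.
elim/mpoly_ring_ind: p => [c|i|p q IHp IHq|p q IHp IHq].
- rewrite mmapC derivC big1 // => i _.
  by rewrite mderivC rmorph0 mul0r.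
- rewrite mmapX mmap1U (bigD1 i) //= big1 => [|j ji].
    rewrite mderivX mnm1E eqxx scale1r (_ : (U_(i) - U_(i))%MM = 0%MM).
      by rewrite mpolyX0 rmorph1 mul1r addr0.
    by apply/mnmP => j; rewrite mnmBE subnn mnm0E.
  by rewrite mderivX mnm1E eq_sym (negbTE ji) scale0r rmorph0 mul0r.
- rewrite rmorphD derivD IHp IHq -big_split; apply: eq_bigr => i _ /=.
  by rewrite mderivD rmorphD mulrDl.
- rewrite rmorphM derivM IHp IHq mulr_suml mulr_sumr -big_split.
  apply: eq_bigr => i _ /=.
  by rewrite mderivM rmorphD !rmorphM mulrDl /= -!mulrA [_^`() * _]mulrC.
Qed.

Section OneSpace.
Variable E : vectType k.
Implicit Types (p : {mpoly k[\dim {:E}]}) (v w : E).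

Definition coords v := fun i => coord (vbasis {:E}) i v.

Lemma coordsD v w i : coords (v + w) i = coords v i + coords w i.
Proof. by rewrite /coords linearD. Qed.

Lemma coordsZ c v i : coords (c *: v) i = c * coords v i.
Proof. by rewrite /coords linearZ. Qed.

Lemma coords_vecE v : v = \sum_i coords v i *: (vbasis {:E})`_i.
Proof. exact: coord_vbasis (memvf v). Qed.

Lemma coords_of (x : 'I_(\dim {:E}) -> k) : exists v, coords v =1 x.
Proof.
exists (\sum_i x i *: (vbasis {:E})`_i) => i.
by rewrite /coords coord_sum_free // (basis_free (vbasisP _)).
Qed.

Definition line_poly p v w : {poly k} :=
  mmap (@polyC k) (fun i => (coords v i)%:P + (coords w i)%:P * 'X) p.

Lemma line_polyE p v w t : (line_poly p v w).[t] = poly_eval p (v + t *: w).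
Proof.
apply: (mpoly_rmorphism_eq
  (F := horner_eval t \o mmap (@polyC k)
    (fun i => (coords v i)%:P + (coords w i)%:P * 'X))
  (G := meval (coords (v + t *: w)))) => [c|i] /=.
  by rewrite mmapC mevalC /horner_eval hornerC.
rewrite mmapX mmap1U mevalXU /horner_eval hornerD hornerCM hornerX hornerC.
by rewrite coordsD coordsZ mulrC.
Qed.

Lemma line_poly_deriv p v w t :
  (line_poly p v w)^`().[t] = poly_diff p (v + t *: w) w.
Proof.
rewrite deriv_mmap horner_sum; apply: eq_bigr => i _.
rewrite hornerM -/(line_poly _ _ _) line_polyE.
by rewrite derivD derivC add0r derivM derivC mul0r add0r derivX mulr1 hornerC.
Qed.

Lemma poly_diffE p v w (q : {poly k}) :
  (forall t, poly_eval p (v + t *: w) = q.[t]) -> poly_diff p v w = q^`().[0].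
Proof.
move=> eqq; rewrite -[v in LHS]addr0 -(scale0r w) -line_poly_deriv.
by rewrite (@poly_eq_of_horner_all (line_poly p v w) q) // => t; rewrite line_polyE.
Qed.

Definition polynomial_map (F : E -> k) := exists p, forall v, poly_eval p v = F v.

Lemma polynomial_const c : polynomial_map (fun=> c).
Proof. by exists c%:MP => v; rewrite /poly_eval mevalC. Qed.

Lemma polynomialD F G : polynomial_map F -> polynomial_map G ->
  polynomial_map (fun v => F v + G v).
Proof.
by move=> [p Fp] [q Gq]; exists (p + q) => v; rewrite /poly_eval mevalD -Fp -Gq.
Qed.

Lemma polynomialM F G : polynomial_map F -> polynomial_map G ->
  polynomial_map (fun v => F v * G v).
Proof.
by move=> [p Fp] [q Gq]; exists (p * q) => v; rewrite /poly_eval mevalM -Fp -Gq.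
Qed.

Lemma polynomial_ext F G : F =1 G -> polynomial_map F -> polynomial_map G.
Proof. by move=> FG [p Fp]; exists p => v; rewrite Fp. Qed.

Lemma polynomialN F : polynomial_map F -> polynomial_map (fun v => - F v).
Proof.
move=> pF; apply: polynomial_ext (polynomialM (polynomial_const (-1)) pF) => v.
by rewrite mulN1r.
Qed.

Lemma polynomial_sum (I : Type) (r : seq I) (F : I -> E -> k) :
  (forall i, polynomial_map (F i)) -> polynomial_map (fun v => \sum_(i <- r) F i v).
Proof.
move=> pF; elim: r => [|i r IH].
  by apply: polynomial_ext (polynomial_const 0) => v; rewrite big_nil.
by apply: polynomial_ext (polynomialD (pF i) IH) => v; rewrite big_cons.
Qed.

Lemma polynomial_prod (I : Type) (r : seq I) (F : I -> E -> k) :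
  (forall i, polynomial_map (F i)) -> polynomial_map (fun v => \prod_(i <- r) F i v).
Proof.
move=> pF; elim: r => [|i r IH].
  by apply: polynomial_ext (polynomial_const 1) => v; rewrite big_nil.
by apply: polynomial_ext (polynomialM (pF i) IH) => v; rewrite big_cons.
Qed.

Lemma polynomialX F n : polynomial_map F -> polynomial_map (fun v => F v ^+ n).
Proof.
move=> pF; elim: n => [|n IH].
  by apply: polynomial_ext (polynomial_const 1) => v; rewrite expr0.
by apply: polynomial_ext (polynomialM pF IH) => v; rewrite exprS.
Qed.

Lemma polynomial_det n (M : E -> 'M[k]_n) :
  (forall i j, polynomial_map (fun v => M v i j)) ->
  polynomial_map (fun v => \det (M v)).
Proof.
move=> pM; apply: polynomial_sum => s; apply: polynomialM.
  exact: polynomial_const.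
by apply: polynomial_prod => i; apply: pM.
Qed.

Lemma polynomial_adj n (M : E -> 'M[k]_n) i j :
  (forall i j, polynomial_map (fun v => M v i j)) ->
  polynomial_map (fun v => (\adj (M v)) i j).
Proof.
move=> pM; apply: (@polynomial_ext (fun v => cofactor (M v) j i)) => [v|].
  by rewrite mxE.
apply: polynomialM; first exact: polynomial_const.
apply: polynomial_det => i' j'.
by apply: polynomial_ext (pM (lift j i') (lift i j')) => v; rewrite !mxE.
Qed.

Lemma polynomial_linear (F : E -> k) :
  (forall c v w, F (c *: v + w) = c * F v + F w) -> polynomial_map F.
Proof.
move=> linF; have F0 : F 0 = 0.
  by have := linF (-1) 0 0; rewrite scaler0 addr0 mulN1r addNr.
apply: (@polynomial_ext (fun v => \sum_i coords v i * F (vbasis {:E})`_i)) => [v|].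
  rewrite [in RHS](coords_vecE v); by elim/big_rec2: _ => [|i y z _ ->].
apply: polynomial_sum => i; apply: polynomialM; last exact: polynomial_const.
by exists 'X_i => v; rewrite /poly_eval mevalXU.
Qed.

Lemma polynomial_line F v w : polynomial_map F ->
  exists q : {poly k}, forall t, q.[t] = F (v + t *: w).
Proof. by move=> [p Fp]; exists (line_poly p v w) => t; rewrite line_polyE. Qed.

(* Affine space is irreducible: restrict to the line through the two points. *)
Lemma polynomial_irreducible F G v w : polynomial_map F -> polynomial_map G ->
  F v != 0 -> G w != 0 -> exists u, F u != 0 /\ G u != 0.
Proof.
move=> /(polynomial_line v (w - v))[q qF] /(polynomial_line v (w - v))[r rG] Fv Gw.
have q0 : q != 0.
  by apply: contraNneq Fv => q0; rewrite -(addr0 v) -(scale0r (w - v)) -qF q0 horner0.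
have r0 : r != 0.
  apply: contraNneq Gw => r0; rewrite -[w](subrKC v) -(scale1r (w - v)).
  by rewrite -rG r0 horner0.
have /closed_nonrootP[t] : q * r != 0 by rewrite mulf_neq0.
rewrite rootM negb_or !rootE qF rG => /andP[Fu Gu].
by exists (v + t *: (w - v)).
Qed.

Lemma zariski_nbhs_polynomial (F : E -> k) v (N : set E) :
  polynomial_map F -> F v != 0 -> (forall u, F u != 0 -> N u) -> zariski_nbhs v N.
Proof.
move=> [p Fp] Fv FN; exists [set u | F u != 0]; split=> //.
exists [set p]; apply/seteqP; split=> u /=.
  by move=> /negP/negPn/eqP Fu _ ->; rewrite Fp.
by move=> /(_ p erefl); rewrite Fp => ->; rewrite eqxx.
Qed.

Lemma zariski_nbhs_basis v (N : set E) : zariski_nbhs v N ->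
  exists p, poly_eval p v != 0 /\ forall u, poly_eval p u != 0 -> N u.
Proof.
move=> [U [[P UP] Uv UN]].
have : ~ (~` U) v by [].
rewrite UP /= => /existsNP[p /not_implyP[Pp /eqP pv]]; exists p; split=> // u pu.
apply: UN; apply: contrapT => nUu; have : (~` U) u by [].
by rewrite UP /= => /(_ p Pp) /eqP; rewrite (negbTE pu).
Qed.

End OneSpace.

Lemma polynomial_comp (E E' : vectType k) (L : {linear E -> E'}) F :
  polynomial_map F -> polynomial_map (fun v => F (L v)).
Proof.
move=> [p Fp]; apply: (@polynomial_ext _ (fun v => poly_eval p (L v))) => [v|].
  by rewrite Fp.
elim/mpoly_ring_ind: p {F Fp} => [c|i|p q IHp IHq|p q IHp IHq].
- by apply: polynomial_ext (polynomial_const E c) => v; rewrite /poly_eval mevalC.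
- apply: polynomial_linear => c v w; rewrite /poly_eval !mevalXU.
  by rewrite !linearP.
- by apply: polynomial_ext (polynomialD IHp IHq) => v; rewrite /poly_eval mevalD.
- by apply: polynomial_ext (polynomialM IHp IHq) => v; rewrite /poly_eval mevalM.
Qed.

Lemma poly_diff_comp (E E' : vectType k) (L : {linear E -> E'}) p p' :
  (forall v, poly_eval p v = poly_eval p' (L v)) ->
  forall v w, poly_diff p v w = poly_diff p' (L v) (L w).
Proof.
move=> eqp v w; rewrite (@poly_diffE _ _ _ _ (line_poly p' (L v) (L w))).
  by rewrite line_poly_deriv scale0r addr0.
by move=> t; rewrite eqp line_polyE linearD linearZ.
Qed.

(** * Polynomials in two groups of variables *)

Section BiPolynomials.
Variables m n : nat.
Implicit Types (P : {mpoly {mpoly k[m]}[n]}) (u : 'I_m -> k) (x : 'I_n -> k).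

Definition bieval u x : {rmorphism {mpoly {mpoly k[m]}[n]} -> k} :=
  mmap (meval u) x.

Lemma bievalE u x P : bieval u x P = mmap (meval u) x P. Proof. by []. Qed.

Lemma bievalC u x a : bieval u x a%:MP = a.@[u].
Proof. by rewrite bievalE mmapC. Qed.

Lemma bieval_lift (p : {mpoly k[n]}) :
  exists P, forall u x, bieval u x P = p.@[x].
Proof.
exists (mmap (@mpolyC n {mpoly k[m]} \o @mpolyC m k) (fun i => 'X_i) p) => u x.
apply: (mpoly_rmorphism_eq (G := meval x) (F := bieval u x \o
  mmap (@mpolyC n {mpoly k[m]} \o @mpolyC m k) (fun i => 'X_i))) => [c|i] /=.
  by rewrite !mmapC /= !mevalC.
by rewrite mmapX mmap1U mmapX mmap1U mevalXU.
Qed.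

(** A point over the dual numbers is a line seen to first order: evaluation at it factors as
    restriction [L] to the line followed by [T], which sends the parameter to eps. *)
Lemma bieval_dual P u u' x x' : exists q : {poly k},
  (forall t, q.[t] = bieval (fun i => u i + t * u' i) (fun i => x i + t * x' i) P)
  /\ mmap (mmap (@dn_const k) (fun i => DualNumber (u i) (u' i)))
       (fun i => DualNumber (x i) (x' i)) P = DualNumber q.[0] q^`().[0].
Proof.
pose lu := mmap (@polyC k) (fun i => (u i)%:P + (u' i)%:P * 'X).
pose L : {rmorphism {mpoly {mpoly k[m]}[n]} -> {poly k}} :=
  mmap lu (fun i => (x i)%:P + (x' i)%:P * 'X).
have LC a : L a%:MP = lu a by rewrite /L /= mmapC.
have LX i : L 'X_i = (x i)%:P + (x' i)%:P * 'X by rewrite /L /= mmapX mmap1U.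
exists (L P); split=> [t|].
  apply: (mpoly_rmorphism_eq (F := horner_eval t \o L)
    (G := bieval _ _)) => [a|i] /=; last first.
    by rewrite LX /horner_eval mmapX mmap1U hornerD hornerCM hornerX hornerC mulrC.
  rewrite LC mmapC.
  apply: (mpoly_rmorphism_eq (F := horner_eval t \o lu)
    (G := meval _)) => [c|i] /=.
    by rewrite /lu mmapC mevalC /horner_eval hornerC.
  by rewrite /lu /horner_eval mmapX mmap1U mevalXU hornerD hornerCM hornerX hornerC mulrC.
pose eps : dual_number k := DualNumber 0 1.
pose T : {rmorphism {poly k} -> dual_number k} :=
  horner_morph (fun c => mulrC eps (@dn_const k c)).
have TC c : T c%:P = dn_const c by rewrite /T /= /horner_morph map_polyC hornerC.
have TX : T 'X = eps by rewrite /T /= /horner_morph map_polyX hornerX.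
have Tlin a b : T (a%:P + b%:P * 'X) = DualNumber a b.
  by rewrite rmorphD rmorphM !TC TX; apply: dnP; rewrite /=; ring.
have TE q : T q = DualNumber q.[0] q^`().[0].
  rewrite /T /= /horner_morph horner_dn -!map_poly_comp.
  have -> : map_poly (@dn_re k \o @dn_const k) q = q.
    by apply/polyP => i; rewrite coef_map_id0.
  have -> : map_poly (@dn_eps k \o @dn_const k) q = 0.
    by apply/polyP => i; rewrite coef_map_id0 // coef0.
  by rewrite horner0 add0r mul1r.
rewrite -TE; apply: (mpoly_rmorphism_eq (G := T \o L)
  (F := mmap (mmap (@dn_const k) _) _)) => [a|i] /=; last first.
  by rewrite LX Tlin mmapX mmap1U.
rewrite LC mmapC; apply: (mpoly_rmorphism_eq (G := T \o lu)
  (F := mmap (@dn_const k) _)) => [c|i] /=.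
  by rewrite /lu !mmapC TC.
by rewrite /lu !mmapX !mmap1U Tlin.
Qed.

End BiPolynomials.
End PolynomialFunctions.

(** * Stabilizers of linear forms *)

Section LinearAlgebra.
Variables (k : fieldType) (E : vectType k).

(** A subspace of largest dimension inside [S] exhausts [S], since a further vector of [S] would
    enlarge it. *)
Lemma vspace_of_set (S : set E) :
  S 0 -> (forall c x y, S x -> S y -> S (c *: x + y)) ->
  exists V : {vspace E}, forall x, x \in V <-> S x.
Proof.
move=> S0 Slin; pose good n := `[< exists V : {vspace E},
  \dim V = n /\ forall x, x \in V -> S x >].
have ex_good : exists n, good n.
  exists 0%N; apply/asboolP; exists 0%VS; split=> [|x]; first exact: dimv0.
  by rewrite memv0 => /eqP ->.
have bound n : good n -> (n <= \dim {:E})%N.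
  by move=> /asboolP[V [<- _]]; apply: dimvS; apply: subvf.
case: (ex_maxnP ex_good bound) => n /asboolP[V [dimV VS]] maxn.
exists V => x; split=> [|Sx]; first exact: VS.
apply: contrapT => /negP nVx.
have : good (\dim (V + <[x]>)%VS).
  apply/asboolP; exists (V + <[x]>)%VS; split=> // _ /memv_addP[u Vu [v /vlineP[c ->] ->]].
  by rewrite addrC; apply: Slin => //; apply: VS.
move/maxn; rewrite -dimV => leV.
have := eqEdim V (V + <[x]>)%VS; rewrite addvSl leV => /eqP eqV.
by move: nVx; rewrite eqV; case/negP; apply: (subvP (addvSr _ _)); apply: memv_line.
Qed.

(** Induction on [ps]. If [p] does not vanish on the common kernel of the rest, choose [z0] there
    with [p z0 != 0] and subtract from [h] the multiple of [p] that agrees with it at [z0]. *)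
Lemma functional_in_span (h : 'Hom(E, k^o)) (ps : seq 'Hom(E, k^o)) :
  (forall z, (forall p, p \in ps -> p z = 0) -> h z = 0) -> h \in <<ps>>%VS.
Proof.
elim: ps h => [|p ps IH] h hker.
  rewrite span_nil memv0; apply/eqP/lfunP => z; rewrite zero_lfunE.
  by apply: hker.
have spanS : {subset <<ps>>%VS <= <<p :: ps>>%VS}.
  by apply/subvP; apply: sub_span => q qps; rewrite inE qps orbT.
have [pker|] := pselect (forall z, (forall q, q \in ps -> q z = 0) -> p z = 0).
  apply: spanS; apply: IH => z zps; apply: hker => q.
  by rewrite inE => /orP[/eqP ->|]; [apply: pker|apply: zps].
move=> /existsNP[z0 /not_implyP[z0ps /eqP pz0]].
have pspan : p \in <<p :: ps>>%VS by apply: memv_span; rewrite inE eqxx.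
rewrite -(subrK ((h z0 / p z0) *: p) h); apply: memvD; last exact: memvZ.
apply: spanS; apply: IH => z zps.
have : h (z - (p z / p z0) *: z0) = 0.
  apply: hker => q; rewrite inE linearB linearZ /= => /orP[/eqP ->|qps].
    by rewrite [_ *: _]mulrVK ?unitfE // subrr.
  by rewrite (zps q qps) (z0ps q qps) scaler0 subrr.
rewrite add_lfunE opp_lfunE scale_lfunE linearB linearZ /= => <-.
by congr (_ - _); rewrite /GRing.scale /= mulrAC [RHS]mulrAC [p z * _]mulrC.
Qed.

Lemma functional_separation (h : 'Hom(E, k^o)) (V : {vspace 'Hom(E, k^o)}) :
  h \notin V -> exists z, h z != 0 /\ forall p, p \in V -> p z = 0.
Proof.
move=> nVh; apply: contrapT => nsep; case/negP: nVh.
rewrite -(span_basis (vbasisP V)); apply: functional_in_span => z zV.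
apply/eqP; apply: contrapT => /negP hz; apply: nsep; exists z; split=> // p Vp.
rewrite (coord_vbasis Vp) sum_lfunE big1 // => i _.
rewrite scale_lfunE zV ?scaler0 //.
by apply: mem_nth; rewrite size_tuple.
Qed.

Lemma lin_span_subset (S T : set E) : S `<=` T -> T 0 ->
  (forall c x y, T x -> T y -> T (c *: x + y)) -> lin_span S `<=` T.
Proof.
move=> ST T0 Tlin z [s sS].
have [V VT] := vspace_of_set T0 Tlin.
move=> zs; apply/VT; apply: (subvP _ _ zs); apply/span_subvP => x xs.
by apply/VT/ST/sS.
Qed.

Lemma subset_lin_span (S : set E) : S `<=` lin_span S.
Proof.
move=> x Sx; exists [:: x]; last by apply: memv_span; rewrite inE.
by move=> y; rewrite inE => /eqP ->.
Qed.

Lemma lin_span0 (S : set E) : lin_span S 0.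
Proof. by exists [::] => //; apply: mem0v. Qed.

Lemma lin_span_linear (S : set E) c x y :
  lin_span S x -> lin_span S y -> lin_span S (c *: x + y).
Proof.
move=> [s sS xs] [t tS yt]; exists (s ++ t).
  by move=> z; rewrite mem_cat => /orP[/sS|/tS].
rewrite span_cat; apply: memv_add => //; exact: memvZ.
Qed.

End LinearAlgebra.

(** * Brackets, and stabilizers under automorphisms *)

Section LieBasics.
Variables (k : closedFieldType) (g : lieAlgType k).
Implicit Types (f h w : 'Hom(g, k^o)) (x y z : g) (a b : 'End(g)).

Lemma lieDl x y z : lie (x + y) z = lie x z + lie y z.
Proof. by have := lie_linear_l z 1 x y; rewrite !scale1r. Qed.
Lemma lieDr x y z : lie z (x + y) = lie z x + lie z y.
Proof. by have := lie_linear_r z 1 x y; rewrite !scale1r. Qed.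
Lemma lie0l z : lie 0 z = 0.
Proof. by apply: (addrI (lie 0 z)); rewrite -lieDl !addr0. Qed.
Lemma lie0r z : lie z 0 = 0.
Proof. by apply: (addrI (lie z 0)); rewrite -lieDr !addr0. Qed.
Lemma lieZl c x z : lie (c *: x) z = c *: lie x z.
Proof. by have := lie_linear_l z c x 0; rewrite !addr0 lie0l addr0. Qed.
Lemma lieZr c x z : lie z (c *: x) = c *: lie z x.
Proof. by have := lie_linear_r z c x 0; rewrite !addr0 lie0r addr0. Qed.
Lemma lieC x y : lie x y = - lie y x.
Proof.
apply/eqP; rewrite -addr_eq0; have := lie_alt (x + y).
by rewrite lieDl !lieDr !lie_alt add0r addr0 => ->.
Qed.
Lemma lie_suml I (r : seq I) (F : I -> g) z :
  lie (\sum_(i <- r) F i) z = \sum_(i <- r) lie (F i) z.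
Proof.
by elim: r => [|i r IH]; rewrite ?big_nil ?lie0l // !big_cons lieDl IH.
Qed.

Lemma functionalP h c x y : h (c *: x + y) = c * h x + h y.
Proof. by rewrite linearP. Qed.

Lemma stab_exists h :
  exists V : {vspace g}, forall x, x \in V <-> coadj_stab h x.
Proof.
apply: vspace_of_set => [y|c x y Sx Sy z]; first by rewrite lie0l linear0.
by rewrite lieDl lieZl functionalP Sx Sy mulr0 addr0.
Qed.

Definition stab h : {vspace g} := sval (cid (stab_exists h)).

Lemma stabP h x : x \in stab h <-> coadj_stab h x.
Proof. exact: (svalP (cid (stab_exists h))). Qed.

Lemma stabr h x y : y \in stab h -> h (lie x y) = 0.
Proof. by move=> /stabP hy; rewrite lieC linearN /= hy oppr0. Qed.

Lemma mem_stab h y : (forall x, h (lie x y) = 0) -> y \in stab h.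
Proof. by move=> hy; apply/stabP => x; rewrite lieC linearN /= hy oppr0. Qed.

Lemma aut_ker a : lie_aut a -> lker a == 0%VS. Proof. by case=> ->. Qed.
Lemma aut_lie a x y : lie_aut a -> a (lie x y) = lie (a x) (a y).
Proof. by case. Qed.
Lemma autK a : lie_aut a -> cancel a (a^-1)%VF.
Proof. by move=> /aut_ker; apply: lker0_lfunK. Qed.
Lemma autVK a : lie_aut a -> cancel (a^-1)%VF a.
Proof. by move=> /aut_ker; apply: lker0_lfunVK. Qed.

Lemma mem_stab_comp h a x :
  lie_aut a -> (x \in stab (h \o a)%VF) = (a x \in stab h).
Proof.
move=> auta; apply/idP/idP => /stabP hx; apply/stabP => y.
  have := hx ((a^-1)%VF y); rewrite comp_lfunE aut_lie // autVK //.
by rewrite comp_lfunE aut_lie.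
Qed.

Lemma dim_img_aut a (V : {vspace g}) : lie_aut a -> \dim (a @: V) = \dim V.
Proof.
move=> /aut_ker/eqP ka; apply: limg_dim_eq; rewrite ka; exact: capv0.
Qed.

Lemma stab_comp h a : lie_aut a -> (a @: stab (h \o a)%VF = stab h)%VS.
Proof.
move=> auta; apply/vspaceP => x; apply/memv_imgP/idP => [[y + ->]|hx].
  by rewrite mem_stab_comp.
by exists ((a^-1)%VF x); rewrite ?autVK // mem_stab_comp // autVK.
Qed.

Lemma coadj_stabE h a f :
  coadj_stab h = [set a x | x in coadj_stab f] <-> (stab h = a @: stab f)%VS.
Proof.
split=> [eqS|eqS].
  apply/vspaceP => x; apply/idP/memv_imgP.
    by move=> /stabP; rewrite eqS => -[y /stabP fy <-]; exists y.
  by move=> [y /stabP fy ->]; apply/stabP; rewrite eqS; exists y.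
apply/seteqP; split=> [x /stabP|_ [y /stabP fy <-]].
  by rewrite eqS => /memv_imgP[y /stabP fy ->]; exists y.
by apply/stabP; rewrite eqS memv_img.
Qed.

Lemma polynomial_bracket (E : vectType k) (L L' : {linear E -> g}) h :
  polynomial_map (fun v => h (lie (L v) (L' v)) : k).
Proof.
apply: (@polynomial_ext _ _ (fun v => \sum_i coords (L v) i *
    (h (lie ((vbasis {:g})`_i) (L' v)) : k))) => [v|].
  rewrite [in RHS](coords_vecE (L v)) lie_suml linear_sum; apply: eq_bigr => i _.
  by rewrite lieZl linearZ.
apply: polynomial_sum => i; apply: polynomialM; apply: polynomial_linear => c v w.
  by rewrite linearP coordsD coordsZ.
by rewrite linearP lieDr lieZr functionalP.
Qed.

Lemma polynomial_coords_app (x : g) i :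
  polynomial_map (fun a : 'End(g) => coords (a x) i).
Proof.
apply: polynomial_linear => c a b.
by rewrite add_lfunE scale_lfunE coordsD coordsZ.
Qed.

Lemma polynomial_value (x : g) :
  polynomial_map (fun h : 'Hom(g, k^o) => h x : k).
Proof.
by apply: polynomial_linear => c h w; rewrite add_lfunE scale_lfunE.
Qed.

End LieBasics.

(** * Algebraic subgroups of Aut g *)

Section AlgebraicSubgroup.
Variables (k : closedFieldType) (g : lieAlgType k).
Implicit Types (f h w : 'Hom(g, k^o)) (x y z : g) (a b X : 'End(g)).

Lemma functional_eq x y : (forall h, h x = h y) -> x = y.
Proof.
move=> eqxy; rewrite (coords_vecE x) (coords_vecE y); apply: eq_bigr => i _.
have := eqxy (linfun (coord (vbasis {:g}) i : g -> k^o)).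
by rewrite !lfunE /coords => ->.
Qed.

(** It covers conjugation, translation in the group and the orbit map of a linear form; polynomials
    are pulled back along these linear maps and differentiated. *)
Definition sandwich (T : vectType k) (u : 'Hom(g, T)) a X := (u \o X \o a)%VF.

Fact sandwich_linear (T : vectType k) (u : 'Hom(g, T)) a : linear (sandwich u a).
Proof.
move=> c X Y; apply/lfunP => z.
by rewrite !(comp_lfunE, add_lfunE, scale_lfunE) linearP.
Qed.
HB.instance Definition _ (T : vectType k) (u : 'Hom(g, T)) a :=
  GRing.isLinear.Build k 'End(g) 'Hom(g, T) _ (sandwich u a) (sandwich_linear u a).

Definition precomp a h : 'Hom(g, k^o) := (h \o a)%VF.

Fact precomp_linear a : linear (precomp a).
Proof.
move=> c h w; apply/lfunP => z.
by rewrite !(comp_lfunE, add_lfunE, scale_lfunE).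
Qed.
HB.instance Definition _ a :=
  GRing.isLinear.Build k 'Hom(g, k^o) 'Hom(g, k^o) _ (precomp a) (precomp_linear a).

Definition app_at x : 'End(g) -> g := fun a => a x.

Fact app_at_linear x : linear (app_at x).
Proof. by move=> c a b; rewrite /app_at add_lfunE scale_lfunE. Qed.
HB.instance Definition _ x :=
  GRing.isLinear.Build k 'End(g) g _ (app_at x) (app_at_linear x).

Lemma polynomial_app x h : polynomial_map (fun a : 'End(g) => h (a x) : k).
Proof.
by apply: polynomial_linear => c a b; rewrite add_lfunE scale_lfunE functionalP.
Qed.

Definition end_det a : k :=
  \det (\matrix_(i, j) coords (a (vbasis {:g})`_i) j).

Lemma end_det_neq0 a : (end_det a != 0) = (lker a == 0%VS).
Proof.
have appE (v : 'rV[k]_(\dim {:g})) j :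
    (v *m \matrix_(i, j) coords (a (vbasis {:g})`_i) j) 0 j
    = coords (a (\sum_i v 0 i *: (vbasis {:g})`_i)) j.
  rewrite mxE linear_sum /coords linear_sum; apply: eq_bigr => i _ /=.
  by rewrite mxE !linearZ.
apply/idP/idP => [/det0P ndet|/lker0P inja].
  apply/lker0P => x y /eqP; rewrite -subr_eq0 -linearB => /eqP axy.
  apply/eqP; rewrite -subr_eq0; apply/eqP; apply: contrapT => /eqP nxy.
  apply: ndet; exists (\row_i coords (x - y) i).
    apply: contraNneq nxy => /rowP coords0.
    rewrite (coords_vecE (x - y)) big1 // => i _.
    by have := coords0 i; rewrite !mxE => ->; rewrite scale0r.
  apply/rowP => j; rewrite appE mxE.
  rewrite (eq_bigr (fun i => coords (x - y) i *: (vbasis {:g})`_i)); last first.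
    by move=> i _; rewrite mxE.
  by rewrite -coords_vecE axy /coords linear0.
apply/det0P => -[v v0 vM]; case/negP: v0; apply/eqP/rowP => i.
have sum0 : \sum_i v 0 i *: (vbasis {:g})`_i = 0.
  apply: inja; rewrite linear0 (coords_vecE (a _)) big1 // => j _.
  by rewrite -appE vM mxE scale0r.
have := congr1 (fun z => coords z i) sum0.
rewrite /coords coord_sum_free ?(basis_free (vbasisP _)) // => ->.
by rewrite linear0 mxE.
Qed.

Lemma polynomial_end_det : polynomial_map end_det.
Proof.
apply: polynomial_det => i j.
by apply: polynomial_ext (polynomial_coords_app (vbasis {:g})`_i j) => a; rewrite mxE.
Qed.

Variables (K : set 'End(g)) (algK : algebraic_subgroup K).

Lemma subgroup_aut a : K a -> lie_aut a.
Proof. by case: algK => -[Z _ ->] _ _ _ []. Qed.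
Lemma subgroup1 : K \1%VF. Proof. by case: algK. Qed.
Lemma subgroupM a b : K a -> K b -> K (a \o b)%VF.
Proof. by case: algK => _ _ KM _; apply: KM. Qed.
Lemma subgroupV a : K a -> K (a^-1)%VF.
Proof. by case: algK => _ _ _; apply. Qed.

Definition in_closure a :=
  forall p, (forall b, K b -> poly_eval p b = 0) -> poly_eval p a = 0.

Lemma in_closure_map (F : 'End(g) -> k) a : in_closure a -> polynomial_map F ->
  (forall b, K b -> F b = 0) -> F a = 0.
Proof.
by move=> cla [p pF] FK; rewrite -pF; apply: cla => b Kb; rewrite pF FK.
Qed.

(** Inside GL(g), preserving brackets and lying in [Z] are polynomial conditions, so [K] is closed
    there. *)
Lemma in_closure_mem a : in_closure a -> end_det a != 0 -> K a.
Proof.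
move=> cla; rewrite end_det_neq0 => ka.
case: (algK) => -[Z [P ZP] KZ] _ _ _; rewrite KZ; split; last first.
  rewrite ZP => p Pp; apply: cla => b; rewrite KZ ZP => -[_]; exact.
split; first exact: ka.
move=> x y; apply: functional_eq => h.
apply/eqP; rewrite -subr_eq0; apply/eqP.
apply: (in_closure_map cla
  (polynomialD (polynomial_app (lie x y) h) (polynomialN (polynomial_bracket (app_at x) (app_at y) h)))).
by move=> b /subgroup_aut autb; rewrite aut_lie // subrr.
Qed.

Lemma poly_diff_linear (E : vectType k) p (v w1 w2 : E) c :
  poly_diff p v (c *: w1 + w2) = c * poly_diff p v w1 + poly_diff p v w2.
Proof.
rewrite /poly_diff mulr_sumr -big_split; apply: eq_bigr => i _ /=.
by rewrite linearP mulrDr mulrCA.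
Qed.

Lemma Lie_of_linear c X Y :
  Lie_of K X -> Lie_of K Y -> Lie_of K (c *: X + Y).
Proof.
by move=> LX LY p pK; rewrite poly_diff_linear LX // LY // mulr0 addr0.
Qed.

Lemma Lie_of0 : Lie_of K 0.
Proof.
move=> p _; rewrite /poly_diff big1 // => i _.
by rewrite linear0 mulr0.
Qed.

(** Chain rule: the pullback of [p] along [L] vanishes on [K], so its differential at the identity
    kills [X]. *)
Lemma Lie_of_diff (E : vectType k) (L : {linear 'End(g) -> E}) p X :
  Lie_of K X -> (forall b, K b -> poly_eval p (L b) = 0) ->
  poly_diff p (L \1%VF) (L X) = 0.
Proof.
move=> LX pK; have [|q qE] := @polynomial_comp _ _ _ L (poly_eval p).
  by exists p.
by rewrite -(poly_diff_comp qE); apply: LX => b Kb; rewrite qE pK.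
Qed.

Lemma Lie_of_conj a X : K a -> Lie_of K X -> Lie_of K (a^-1 \o X \o a)%VF.
Proof.
move=> Ka LX p pK.
have := @Lie_of_diff _ (sandwich (a^-1)%VF a) p X LX.
rewrite /= /sandwich comp_lfun1r lker0_compVf ?(aut_ker (subgroup_aut Ka)) //; apply.
by move=> b Kb; apply: pK; do 2?apply: subgroupM => //; apply: subgroupV.
Qed.

(** Right translation by the inverse of [a] carries [K] to itself and [a] to the identity. *)
Lemma tangent_Lie_of a X : K a -> tangent_space K a X -> Lie_of K (X \o a^-1)%VF.
Proof.
move=> Ka tX p pK.
have [|q qE] := @polynomial_comp _ _ _ (sandwich \1%VF (a^-1)%VF) (poly_eval p).
  by exists p.
have := poly_diff_comp qE a X.
rewrite /= /sandwich !comp_lfun1l lker0_compfV ?(aut_ker (subgroup_aut Ka)) // => <-.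
apply: tX => b Kb; rewrite qE /= /sandwich comp_lfun1l; apply: pK.
by apply: subgroupM => //; apply: subgroupV.
Qed.

(** Differentiate at the identity the equation saying that elements of [K] preserve the bracket. *)
Lemma Lie_of_derivation X x y :
  Lie_of K X -> X (lie x y) = lie (X x) y + lie x (X y).
Proof.
move=> LX; apply: functional_eq => h.
have [p pE] := polynomialD (polynomial_app (lie x y) h)
  (polynomialN (polynomial_bracket (app_at x) (app_at y) h)).
have : poly_diff p \1%VF X = 0.
  by apply: LX => b Kb; rewrite pE aut_lie ?subrr //; apply: subgroup_aut.
(* Along the line from the identity in the direction [X] the equation becomes [t * (c1 - c2 * t)],
   with derivative [c1] at 0. *)
pose c1 : k := h (X (lie x y)) - h (lie (X x) y + lie x (X y)).
pose c2 : k := h (lie (X x) (X y)).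
rewrite (@poly_diffE _ _ _ _ _ ('X * (c1%:P - c2%:P * 'X))) => [|t]; last first.
  rewrite pE !hornerE /= /app_at !(add_lfunE, scale_lfunE, id_lfunE) /c1 /c2.
  rewrite !(lieDl, lieDr, lieZl, lieZr) !(linearD, linearZ) /= /GRing.scale /=.
  by ring.
rewrite derivM derivX mul1r hornerD hornerM hornerX mul0r addr0.
rewrite hornerD hornerN hornerM hornerX mulr0 subr0 hornerC => /eqP.
by rewrite subr_eq0 => /eqP.
Qed.

End AlgebraicSubgroup.

(** * Transversality of k.f to the annihilator W of [g, g^f] *)

Section Transversality.
Variables (k : closedFieldType) (g : lieAlgType k).
Implicit Types (f h w : 'Hom(g, k^o)) (x y z : g) (a b X : 'End(g)).
Variables (K : set 'End(g)) (algK : algebraic_subgroup K).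

Definition annih f h := forall x y, y \in stab f -> h (lie x y) = 0.

Lemma annih_linear f c h w : annih f h -> annih f w -> annih f (c *: h + w).
Proof.
by move=> fh fw x y fy; rewrite add_lfunE scale_lfunE fh // fw // scaler0 addr0.
Qed.

Lemma annih_self f : annih f f.
Proof. by move=> x y; apply: stabr. Qed.

Lemma annih_stab f h : annih f h -> (stab f <= stab h)%VS.
Proof. by move=> fh; apply/subvP => y fy; apply: mem_stab => x; apply: fh. Qed.

Lemma annih_eq f h w : stab f = stab h -> annih f w -> annih h w.
Proof. by move=> eqS fw x y; rewrite -eqS; apply: fw. Qed.

(** Composition with the projection onto [U], the span of the brackets, has kernel W, so its image
    is a model of the quotient g^*/W. *)
Lemma bracket_spaceP f : exists U : {vspace g},
  (forall z, z \in U <-> bracket_span [set: g] (coadj_stab f) z) /\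
  forall h, annih f h <-> precomp (projv U) h = 0.
Proof.
have [U UP] := vspace_of_set (lin_span0 _)
  (@lin_span_linear _ _ [set z | exists x y, [/\ [set: g] x, coadj_stab f y & z = lie x y]]).
exists U; split=> // h; split=> [fh|hU x y fy].
  apply/lfunP => z; rewrite /precomp comp_lfunE zero_lfunE.
  have /UP := memv_proj U z; apply: (@lin_span_subset _ _ _ [set z | h z = 0]) => /=.
  - by move=> _ [x [y [_ /stabP fy ->]]]; apply: fh.
  - by rewrite linear0.
  - by move=> c u v hu hv; rewrite functionalP hu hv mulr0 addr0.
have Uxy : lie x y \in U.
  by apply/UP; apply: subset_lin_span; exists x, y; split=> //; apply/stabP.
have := congr1 (fun l : 'Hom(g, k^o) => l (lie x y)) hU.
by rewrite /precomp comp_lfunE projv_id // zero_lfunE.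
Qed.

Lemma Lie_space : exists V : {vspace 'End(g)}, forall X, X \in V <-> Lie_of K X.
Proof. by apply: vspace_of_set; [exact: Lie_of0|exact: Lie_of_linear]. Qed.

(* [transverse f] says that f is an interior point of K.W "to first order",
   W being the space of forms vanishing on [g, g^f]. *)
Definition transverse f :=
  forall h, exists X, Lie_of K X /\ annih f (h + (f \o X)%VF).

(** By finite-dimensional duality the intersection is zero exactly when k.f and W together span
    g^*. *)
Lemma transverseP f :
  bracket_span [set: g] (coadj_stab f) `&` annihilated (Lie_of K) f = [set 0]
  <-> transverse f.
Proof.
have [U [UP annU]] := bracket_spaceP f.
have annihilatedE x : annihilated (Lie_of K) f x <->
    forall X, Lie_of K X -> f (X x) = 0.
  split=> [fx X LX|fx X LX].
    by have := fx X LX; rewrite /dual_act opp_lfunE comp_lfunE => /eqP; rewrite oppr_eq0 => /eqP.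
  by rewrite /dual_act opp_lfunE comp_lfunE fx // oppr0.
split=> [eq0 h|trf].
  have [kk kkP] := Lie_space.
  (* [R] is the image of k.f in g^*/W. A form outside it is separated from it by some [z], and then
     [projv U z] is a nonzero element of the intersection. *)
  pose R := (linfun (sandwich f (projv U)) @: kk)%VS.
  have [/memv_imgP[X /kkP LX]|/functional_separation[z [hz Rz]]] :=
      boolP (precomp (projv U) h \in R).
    rewrite lfunE /= => eqX; exists (- X); split.
      by rewrite -[- X]addr0 -scaleN1r; apply: Lie_of_linear => //; exact: Lie_of0.
    apply/annU; apply/lfunP => z; have := congr1 (fun l : 'Hom(g, k^o) => l z) eqX.
    rewrite /precomp /sandwich zero_lfunE !comp_lfunE add_lfunE comp_lfunE => ->.
    by rewrite opp_lfunE linearN addrN.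
  have : (bracket_span [set: g] (coadj_stab f) `&` annihilated (Lie_of K) f) (projv U z).
    split; first by apply/UP/memv_proj.
    apply/annihilatedE => X LX.
    have /Rz : sandwich f (projv U) X \in R.
      by apply/memv_imgP; exists X; [exact/kkP|rewrite lfunE].
    by rewrite /sandwich !comp_lfunE.
  rewrite eq0 => /= Uz0; move: hz.
  by rewrite /precomp comp_lfunE Uz0 linear0 eqxx.
apply/seteqP; split=> [z [/UP Uz /annihilatedE fz] /=|_ -> /=]; last first.
  split; first by apply/UP/mem0v.
  by apply/annihilatedE => X _; rewrite !linear0.
apply: functional_eq => h; rewrite linear0.
have [X [LX /annU fX]] := trf h.
have := congr1 (fun l : 'Hom(g, k^o) => l z) fX.
by rewrite /precomp zero_lfunE comp_lfunE projv_id // add_lfunE comp_lfunE fz // addr0.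
Qed.

(* The kernel of [X |-> (w \o X)] modulo forms vanishing on [g, g^f] is the
   stabilizer of g^f, so its rank is the same at f and at w. *)
Lemma transverse_eq_stab f w : stab f = stab w -> transverse f -> transverse w.
Proof.
move=> eqS trf; have [U [UP annU]] := bracket_spaceP f.
have annUw h : annih w h <-> precomp (projv U) h = 0.
  by split=> [/(annih_eq (esym eqS))/annU|/annU/(annih_eq eqS)].
have [kk kkP] := Lie_space.
pose R h : 'Hom('End(g), 'Hom(g, k^o)) := linfun (sandwich h (projv U)).
pose Y : {vspace 'Hom(g, k^o)} := limg (linfun (precomp (projv U))).
have RY h : (R h @: kk <= Y)%VS.
  apply/subvP => _ /memv_imgP[X _ ->]; apply/memv_imgP; exists (h \o X)%VF.
    exact: memvf.
  by rewrite !lfunE.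
(* Transversality at [h] says that [R h] maps the Lie algebra onto [Y], the model of g^*/W. *)
have trP h : (forall l, annih h l <-> precomp (projv U) l = 0) ->
    transverse h <-> (Y <= R h @: kk)%VS.
  move=> annUh; split=> [trh|/subvP YR l].
    apply/subvP => _ /memv_imgP[l _ ->]; have [X [LX /annUh lX]] := trh (- l).
    apply/memv_imgP; exists X; first exact/kkP.
    move: lX; rewrite !lfunE linearD linearN /= addrC => /eqP.
    by rewrite subr_eq0 => /eqP <-.
  have /YR/memv_imgP[X /kkP LX] : precomp (projv U) l \in Y.
    by apply/memv_imgP; exists l; [exact: memvf|rewrite lfunE].
  rewrite lfunE /= => eqX; exists (- X); split.
    by rewrite -[- X]addr0 -scaleN1r; apply: Lie_of_linear => //; exact: Lie_of0.
  apply/annUh/lfunP => z; have := congr1 (fun l : 'Hom(g, k^o) => l z) eqX.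
  rewrite /precomp /sandwich zero_lfunE !comp_lfunE add_lfunE comp_lfunE => ->.
  by rewrite opp_lfunE linearN addrN.
(* As [X] is a derivation, [h (X [x, y])] reduces to [h [x, X y]] for [y] in g^h, and this vanishes
   for all [x] exactly when [X y] is in g^h. *)
have kerP h : (forall l, annih h l <-> precomp (projv U) l = 0) -> forall X,
    (X \in (kk :&: lker (R h))%VS) <->
    (Lie_of K X /\ forall y, y \in stab h -> X y \in stab h).
  move=> annUh X; rewrite memv_cap memv_ker lfunE /=; split.
    move=> /andP[/kkP LX /eqP/annUh hX]; split=> // y hy; apply: mem_stab => x.
    have := hX x y hy; rewrite comp_lfunE (Lie_of_derivation algK) // linearD /=.
    by rewrite (stabr _ hy) add0r.
  move=> [LX Xstab]; apply/andP; split; first exact/kkP.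
  apply/eqP/annUh => x y hy.
  rewrite comp_lfunE (Lie_of_derivation algK) // linearD /=.
  by rewrite (stabr _ hy) add0r; apply: stabr; apply: Xstab.
have kerE : (kk :&: lker (R f) = kk :&: lker (R w))%VS.
  by apply/vspaceP => X; apply/idP/idP => [/(kerP _ annU)|/(kerP _ annUw)] [LX XS];
    [apply/(kerP _ annUw)|apply/(kerP _ annU)]; split=> // y;
    [rewrite -eqS|rewrite eqS]; apply: XS.
have dimE : \dim (R w @: kk) = \dim (R f @: kk).
  have := limg_ker_dim (R f) kk; rewrite -(limg_ker_dim (R w) kk) kerE.
  by move/addnI.
apply/(trP _ annUw); rewrite -(geq_leqif (dimv_leqif_sup (RY w))) dimE.
by apply: dimvS; apply/(trP _ annU).
Qed.

Lemma transverse_comp f a : K a -> transverse f -> transverse (f \o a)%VF.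
Proof.
move=> Ka trf h; have auta := subgroup_aut algK Ka.
have [X [LX fX]] := trf (h \o a^-1)%VF.
exists (a^-1 \o X \o a)%VF; split; first exact: Lie_of_conj.
move=> x y; rewrite mem_stab_comp // => fy.
have := fX (a x) (a y) fy.
rewrite !add_lfunE !comp_lfunE -aut_lie // autK //.
by rewrite autVK.
Qed.

End Transversality.

(** * Charts around the stabilizer of a linear form *)

Section Chart.
Variables (k : closedFieldType) (g : lieAlgType k) (f : 'Hom(g, k^o)).
Implicit Types (h w : 'Hom(g, k^o)) (x y z : g).

Definition chart_space : {vspace g} := (stab f)^C.
Local Notation M := chart_space.
Local Notation d := (\dim M).
Local Notation n := (\dim {:g}).

Definition gram h : 'M[k]_d := \matrix_(i, j) h (lie (vbasis M)`_i (vbasis M)`_j).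
Definition chart_det h := \det (gram h).
Definition gram_ext h : 'M[k]_(d, n) :=
  \matrix_(i, j) h (lie (vbasis M)`_i (vbasis {:g})`_j).

(* When g = M + g^h is direct, this is the matrix of the projection onto M
   along g^h. *)
Definition proj_along h : 'M[k]_(d, n) := invmx (gram h) *m gram_ext h.

Definition mx_app (t : 'M[k]_(d, n)) x : 'cV[k]_d := t *m \col_j coords x j.

Lemma gram_ext_app h x :
  mx_app (gram_ext h) x = \col_i h (lie (vbasis M)`_i x).
Proof.
apply/colP => i; rewrite !mxE [in RHS](coords_vecE x).
have -> : lie (vbasis M)`_i (\sum_j coords x j *: (vbasis {:g})`_j)
    = \sum_j coords x j *: lie (vbasis M)`_i (vbasis {:g})`_j.
  rewrite lieC lie_suml -sumrN; apply: eq_bigr => j _.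
  by rewrite lieC lieZr opprK.
rewrite linear_sum; apply: eq_bigr => j _.
by rewrite !mxE linearZ mulrC.
Qed.

Lemma gram_unit h : (gram h \in unitmx) = (chart_det h != 0).
Proof. by rewrite unitmxE unitfE. Qed.

Lemma proj_along_app h x : chart_det h != 0 ->
  gram h *m mx_app (proj_along h) x = \col_i h (lie (vbasis M)`_i x).
Proof.
rewrite -gram_unit => uG.
by rewrite /mx_app /proj_along -!mulmxA mulKVmx // -gram_ext_app.
Qed.

Lemma mx_app_linear t c x y :
  mx_app t (c *: x + y) = c *: mx_app t x + mx_app t y.
Proof.
rewrite /mx_app scalemxAr -mulmxDr; congr (_ *m _).
by apply/colP => j; rewrite !mxE coordsD coordsZ.
Qed.

Lemma gram_mul h (c : 'cV[k]_d) :
  gram h *m c = \col_i h (lie (vbasis M)`_i (\sum_j c j 0 *: (vbasis M)`_j)).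
Proof.
apply/colP => i; rewrite !mxE.
have -> : lie (vbasis M)`_i (\sum_j c j 0 *: (vbasis M)`_j)
    = \sum_j c j 0 *: lie (vbasis M)`_i (vbasis M)`_j.
  rewrite lieC lie_suml -sumrN; apply: eq_bigr => j _.
  by rewrite lieC lieZr opprK.
rewrite linear_sum; apply: eq_bigr => j _.
by rewrite !mxE linearZ mulrC.
Qed.

Lemma mem_chart_space x : x \in M ->
  x = \sum_j (\col_j coord (vbasis M) j x) j 0 *: (vbasis M)`_j.
Proof.
by move=> Mx; rewrite [LHS](coord_vbasis Mx); apply: eq_bigr => j _; rewrite mxE.
Qed.

Lemma chart_cap h : chart_det h != 0 -> (M :&: stab h)%VS = 0%VS.
Proof.
move=> uG; apply/eqP; rewrite -subv0; apply/subvP => x.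
rewrite memv_cap memv0 => /andP[Mx hx]; rewrite (mem_chart_space Mx).
have : gram h *m \col_j coord (vbasis M) j x = 0.
  rewrite gram_mul -mem_chart_space //; apply/colP => i.
  by rewrite !mxE stabr.
move/(congr1 (mulmx (invmx (gram h)))); rewrite mulKmx ?gram_unit // mulmx0 => ->.
by rewrite big1 // => j _; rewrite mxE scale0r.
Qed.

Lemma dim_chart : (\dim M + \dim (stab f) = n)%N.
Proof. by rewrite dimv_compl subnK // dimvS // subvf. Qed.

Lemma chart_dim_le h : chart_det h != 0 -> (\dim (stab h) <= \dim (stab f))%N.
Proof.
move=> /chart_cap cap0; rewrite -(leq_add2l (\dim M)) dim_chart.
by rewrite -dimv_disjoint_sum // dimvS // subvf.
Qed.

Lemma chart_sum h : (M :&: stab h)%VS = 0%VS -> \dim (stab h) = \dim (stab f) ->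
  (M + stab h)%VS = fullv.
Proof.
move=> cap0 dimE; apply/eqP; rewrite eqEdim subvf /=.
by rewrite dimv_disjoint_sum // dimE dim_chart.
Qed.

(** A vector of [M] orthogonal to [M] for the form induced by [h] is also orthogonal to g^h, hence
    to all of g, so it lies in both [M] and g^h. *)
Lemma chart_det_neq0 h : (M :&: stab h)%VS = 0%VS ->
  \dim (stab h) = \dim (stab f) -> chart_det h != 0.
Proof.
move=> cap0 dimE; apply/negP => /eqP det0.
have /eqP : \det (gram h)^T = 0 by rewrite det_tr.
case/det0P => v v0 vG; case/negP: v0.
have Gv : gram h *m v^T = 0.
  by rewrite -[LHS]trmxK trmx_mul trmxK vG trmx0.
pose x := \sum_j v^T j 0 *: (vbasis M)`_j.
have Mx : x \in M.
  by apply: memv_suml => j _; apply/memvZ/vbasis_mem/mem_nth; rewrite size_tuple.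
have : x \in (M :&: stab h)%VS.
  rewrite memv_cap Mx /=; apply: mem_stab => y.
  have : y \in (M + stab h)%VS by rewrite chart_sum // memvf.
  move=> /memv_addP[u Mu [s hs ->]]; rewrite lieDl linearD /=.
  move/stabP: hs => ->; rewrite addr0 (mem_chart_space Mu) lie_suml linear_sum big1 // => i _.
  rewrite lieZl linearZ /=; have := congr1 (fun c : 'cV[k]_d => c i 0) Gv.
  by rewrite gram_mul !mxE => ->; rewrite scaler0.
rewrite cap0 memv0 => /eqP x0; apply/eqP/rowP => j.
have := congr1 (coord (vbasis M) j) x0.
rewrite /x coord_sum_free ?(basis_free (vbasisP _)) //.
by rewrite !mxE linear0.
Qed.

Lemma chart_det_base : chart_det f != 0.
Proof. by apply: chart_det_neq0 => //; rewrite capvC capv_compl. Qed.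

(** The projection of [x] vanishes exactly when [x] is orthogonal to [M]; as g = [M] + g^h, such an
    [x] is in g^h. *)
Lemma proj_along_ker h x : chart_det h != 0 -> \dim (stab h) = \dim (stab f) ->
  mx_app (proj_along h) x = 0 <-> x \in stab h.
Proof.
move=> uG dimE; split=> [px|hx].
  apply: mem_stab => y.
  have : y \in (M + stab h)%VS by rewrite chart_sum ?memvf ?chart_cap.
  move=> /memv_addP[u Mu [s hs ->]]; rewrite lieDl linearD /=.
  move/stabP: hs => ->; rewrite addr0 (mem_chart_space Mu) lie_suml linear_sum big1 // => i _.
  rewrite lieZl linearZ /=; have := proj_along_app x uG.
  rewrite px mulmx0 => /(congr1 (fun c : 'cV[k]_d => c i 0)).
  by rewrite !mxE => <-; rewrite scaler0.
have /(congr1 (mulmx (invmx (gram h)))) := proj_along_app x uG.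
rewrite mulKmx ?gram_unit // => ->; rewrite (_ : \col_i _ = 0) ?mulmx0 //.
by apply/colP => i; rewrite !mxE stabr.
Qed.

Lemma proj_along_id h (c : 'cV[k]_d) : chart_det h != 0 ->
  mx_app (proj_along h) (\sum_j c j 0 *: (vbasis M)`_j) = c.
Proof.
move=> uG; have := proj_along_app (\sum_j c j 0 *: (vbasis M)`_j) uG.
rewrite -gram_mul => /(congr1 (mulmx (invmx (gram h)))).
by rewrite !mulKmx ?gram_unit.
Qed.

Lemma mx_app_inj t t' : (forall x, mx_app t x = mx_app t' x) -> t = t'.
Proof.
move=> eqt; apply/matrixP => i j.
have := congr1 (fun c : 'cV[k]_d => c i 0) (eqt (vbasis {:g})`_j).
have col_basis : \col_l coords (vbasis {:g})`_j l = delta_mx j 0 :> 'cV[k]_n.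
  apply/colP => l; rewrite !mxE /coords coord_free ?(basis_free (vbasisP _)) //.
  by rewrite eqxx andbT eq_sym.
by rewrite /mx_app col_basis -!colE !mxE.
Qed.

(** A projection is determined by its image and its kernel. *)
Lemma proj_along_eq h w : chart_det h != 0 -> chart_det w != 0 ->
  \dim (stab h) = \dim (stab f) -> stab h = stab w -> proj_along h = proj_along w.
Proof.
move=> uh uw dimE eqS; apply: mx_app_inj => x.
pose c := mx_app (proj_along h) x.
have : x - \sum_j c j 0 *: (vbasis M)`_j \in stab h.
  apply/(proj_along_ker _ uh dimE).
  rewrite addrC -scaleN1r mx_app_linear proj_along_id // scaleN1r.
  by rewrite /c addNr.
rewrite eqS => /(proj_along_ker _ uw) => /(_ (etrans (congr1 _ (esym eqS)) dimE)).
rewrite addrC -scaleN1r mx_app_linear proj_along_id // scaleN1r addrC => /eqP.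
by rewrite subr_eq0 => /eqP ->.
Qed.

Lemma polynomial_gram i j : polynomial_map (fun h => gram h i j).
Proof.
apply: polynomial_ext (polynomial_value (lie (vbasis M)`_i (vbasis M)`_j)) => h.
by rewrite mxE.
Qed.

Lemma polynomial_chart_det : polynomial_map chart_det.
Proof. by apply: polynomial_det; apply: polynomial_gram. Qed.

Definition proj_coords h : 'I_(d * n) -> k := fun i => mxvec (proj_along h) 0 i.

(** Cramer's rule: [chart_det h] is the only denominator in [proj_along h]. *)
Lemma proj_coords_regular i : exists F, polynomial_map F /\
  forall h, chart_det h != 0 -> F h = chart_det h * proj_coords h i.
Proof.
case/mxvec_indexP: i => i j.
exists (fun h => \sum_l (\adj (gram h)) i l * gram_ext h l j); split.
  apply: polynomial_sum => l; apply: polynomialM.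
    exact/polynomial_adj/polynomial_gram.
  apply: polynomial_ext (polynomial_value (lie (vbasis M)`_l (vbasis {:g})`_j)) => h.
  by rewrite mxE.
move=> h uh; rewrite /proj_coords mxvecE mxE mulr_sumr; apply: eq_bigr => l _.
by rewrite /invmx gram_unit uh [in RHS]mxE -[_ * _ * gram_ext h l j]mulrA mulVKf.
Qed.

Lemma regular_clear_denominator (p : {mpoly k[d * n]}) :
  exists N F, polynomial_map F /\
  forall h, chart_det h != 0 -> F h = chart_det h ^+ N * p.@[proj_coords h].
Proof.
elim/mpoly_ring_ind: p => [c|i|p q [N [F [pF FE]]] [N' [F' [pF' FE']]]|
    p q [N [F [pF FE]]] [N' [F' [pF' FE']]]].
- exists 0%N, (fun=> c); split; first exact: polynomial_const.
  by move=> h _; rewrite mevalC mul1r.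
- have [F [pF FE]] := proj_coords_regular i; exists 1%N, F; split=> // h uh.
  by rewrite mevalXU FE.
- exists (N + N')%N, (fun h => chart_det h ^+ N' * F h + chart_det h ^+ N * F' h).
  split; first by apply: polynomialD; apply: polynomialM => //;
    apply: polynomialX; apply: polynomial_chart_det.
  by move=> h uh; rewrite FE // FE' // mevalD exprD; ring.
- exists (N + N')%N, (fun h => F h * F' h); split; first exact: polynomialM.
  by move=> h uh; rewrite FE // FE' // mevalM exprD; ring.
Qed.

End Chart.

Arguments proj_along {k g} f h.
Arguments proj_coords {k g} f h i.

(** * Density of the K-translates of W *)

Section Density.
Variables (k : closedFieldType) (char0 : [pchar k] =i pred0) (g : lieAlgType k).
Variables (K : set 'End(g)) (algK : algebraic_subgroup K) (f : 'Hom(g, k^o)).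
Implicit Types (h w : 'Hom(g, k^o)) (x y z : g) (a b X : 'End(g)).

Lemma annih_stab_eq w : annih f w -> chart_det f w != 0 -> stab f = stab w.
Proof.
by move=> /annih_stab fw /chart_dim_le lew; apply/eqP; rewrite eqEdim fw lew.
Qed.

(** The translates of an open part of W on which all stabilizers equal g^f; composing with [a] is
    the action of its inverse. *)
Definition conj_locus h := exists a w,
  [/\ K a, annih f w, chart_det f w != 0 & h = (w \o a)%VF].

Lemma conj_locus_base : conj_locus f.
Proof.
exists \1%VF, f; split; [exact: subgroup1|exact: annih_self| |].
  exact: chart_det_base.
by rewrite comp_lfun1r.
Qed.

Lemma conj_locus_stab h : conj_locus h ->
  exists a, K a /\ stab h = (a @: stab f)%VS.
Proof.
move=> [a [w [Ka fw uw ->]]]; exists (a^-1)%VF; split; first exact: subgroupV.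
have auta := subgroup_aut algK Ka.
rewrite (annih_stab_eq fw uw) -(stab_comp w auta) -limg_comp.
by rewrite lker0_compVf ?aut_ker // -[LHS]lim1g.
Qed.

(** A polynomial rather than a value, so that it can be iterated. *)
Definition dir_deriv (v : 'Hom(g, k^o)) (p : {mpoly k[\dim {:'Hom(g, k^o)}]}) :=
  \sum_i coords v i *: p^`M(i).

Lemma dir_derivE v p h : poly_eval (dir_deriv v p) h = poly_diff p h v.
Proof.
rewrite /poly_eval /dir_deriv rmorph_sum; apply: eq_bigr => i _ /=.
by rewrite mevalZ mulrC.
Qed.

(** Transversality at [w] splits [v] into a direction tangent to the K-translates of [w] and a
    translate of a direction in W; the derivative of [p] vanishes along both. *)
Lemma dir_deriv_conj_locus v p : transverse K f ->
  (forall h, conj_locus h -> poly_eval p h = 0) ->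
  forall h, conj_locus h -> poly_eval (dir_deriv v p) h = 0.
Proof.
move=> trf pC h [a [w [Ka fw uw hE]]]; rewrite dir_derivE.
have auta := subgroup_aut algK Ka.
have trw := transverse_eq_stab algK (annih_stab_eq fw uw) trf.
have [X [LX wX]] := trw (v \o a^-1)%VF.
set w1 := ((v \o a^-1) + (w \o X))%VF in wX.
have vE : v = (-1) *: (w \o X \o a)%VF + (w1 \o a)%VF.
  apply/lfunP => z; rewrite /w1 !(add_lfunE, scale_lfunE, comp_lfunE).
  by rewrite autK // scaleN1r addrC addrK.
have fw1 : annih f w1 by apply: annih_eq wX; rewrite (annih_stab_eq fw uw).
have -> : v = (-1) *: sandwich w a X + precomp a w1 by [].
rewrite poly_diff_linear.
have -> : poly_diff p h (sandwich w a X) = 0.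
  have /= := @Lie_of_diff _ _ K _ (sandwich w a) p X LX.
  have -> : sandwich w a \1%VF = h by rewrite /sandwich comp_lfun1r hE.
  apply=> b Kb.
  apply: pC; exists (b \o a)%VF, w; split=> //; first exact: subgroupM.
  by rewrite /sandwich comp_lfunA.
rewrite mulr0 add0r.
(* The line through [w] in the direction [w1] stays in W and leaves the chart at finitely many
   parameters only, so [p] vanishes on its translate. *)
have [q qE] := polynomial_line w w1 (polynomial_chart_det f).
have q0 : q != 0.
  by apply: contraNneq uw => q0; rewrite -[w]addr0 -(scale0r w1) -qE q0 horner0.
have line0 : line_poly p h (precomp a w1) = 0.
  apply: (poly_eq_of_horner q0) => t; rewrite qE => ut.
  rewrite line_polyE horner0; apply: pC; exists a, (w + t *: w1); split=> //.
    by rewrite addrC; apply: annih_linear.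
  by rewrite hE /precomp comp_lfunDl comp_lfunZl.
have := line_poly_deriv p h (precomp a w1) 0.
by rewrite line0 deriv0 horner0 scale0r addr0 => <-.
Qed.

(** All iterated derivatives of [p] in the direction [h - f] vanish at [f], so in characteristic 0
    [p] vanishes on the line from [f] to [h]. *)
Lemma conj_locus_dense (F : 'Hom(g, k^o) -> k) : transverse K f ->
  polynomial_map F -> (forall h, conj_locus h -> F h = 0) -> forall h, F h = 0.
Proof.
move=> trf [p pF] FC h; rewrite -pF; have {}FC h' : conj_locus h' -> poly_eval p h' = 0.
  by rewrite pF; apply: FC.
pose v := h - f; pose pn n := iter n (dir_deriv v) p.
have pnC n h' : conj_locus h' -> poly_eval (pn n) h' = 0.
  elim: n h' => [|n IH] h' Ch' /=; first exact: FC.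
  exact: dir_deriv_conj_locus Ch'.
have derivE n : (line_poly p f v)^`(n) = line_poly (pn n) f v.
  elim: n => [|n IH]; rewrite ?derivn0 // derivnS IH.
  apply: poly_eq_of_horner_all => t.
  by rewrite line_poly_deriv line_polyE dir_derivE.
have line0 : line_poly p f v = 0.
  apply/polyP => n; rewrite coef0.
  have : ((line_poly p f v)^`(n)).[0] = 0.
    by rewrite derivE line_polyE scale0r addr0 pnC //; apply: conj_locus_base.
  rewrite horner_coef0 coef_derivn addn0 ffactnn -mulr_natr => /eqP.
  rewrite mulf_eq0 => /orP[/eqP //|].
  by move/pcharf0P: char0 => ->; rewrite eqn0Ngt fact_gt0.
have := line_polyE p f v 1; rewrite line0 horner0 scale1r /v addrC subrK => <- //.
Qed.

Lemma conj_locus_meets F : transverse K f -> polynomial_map F ->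
  (exists h, F h != 0) -> exists h, conj_locus h /\ F h != 0.
Proof.
move=> trf pF [h Fh]; apply: contrapT => nC; case/negP: Fh; apply/eqP.
apply: (conj_locus_dense trf pF) => h' Ch'.
by apply/eqP; apply: contrapT => /negP Fh'; apply: nC; exists h'.
Qed.

(** The dense set of conjugates meets the chart around any [h], where stabilizers have dimension at
    most that of g^h. *)
Lemma transverse_dim_le h : transverse K f -> (\dim (stab f) <= \dim (stab h))%N.
Proof.
move=> trf.
have [|h' [/conj_locus_stab[a [Ka eqS]] uh']] :=
  conj_locus_meets trf (polynomial_chart_det h).
  by exists h; apply: chart_det_base.
rewrite -(dim_img_aut (stab f) (subgroup_aut algK Ka)) -eqS.
exact: chart_dim_le uh'.
Qed.

End Density.

(** * Stability and transversality *)

Section MainTheorem.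
Variables (k : closedFieldType) (char0 : [pchar k] =i pred0) (g : lieAlgType k).
Variables (K : set 'End(g)) (algK : algebraic_subgroup K).
Implicit Types (f h w : 'Hom(g, k^o)) (x y z : g) (a b X : 'End(g)).

Lemma mmap_dn_const m (v : 'I_m -> k) (p : {mpoly k[m]}) :
  mmap (@dn_const k) (fun j => DualNumber (v j) 0) p = dn_const p.@[v].
Proof.
apply: (mpoly_rmorphism_eq (F := mmap (@dn_const k) _)
  (G := @dn_const k \o meval _)) => [e|j] /=; first by rewrite mmapC mevalC.
by rewrite mmapX mmap1U mevalXU.
Qed.

(** [dominant_lift] for the family of pairs [(u i, alpha i)], with the determinant as the function
    kept nonzero, so that the lifted endomorphism is invertible and stays in [K]. The relations [P]
    of the family hold to first order along the lifted tangent vector [(v', b')]. *)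
Lemma subgroup_lift (I : Type) m (u : I -> 'I_m -> k) (alpha : I -> 'End(g)) :
  inhabited I ->
  (forall c c' : {mpoly k[m]}, (exists i, c.@[u i] != 0) ->
     (exists i, c'.@[u i] != 0) -> exists i, (c * c').@[u i] != 0) ->
  (forall i, K (alpha i)) ->
  exists c : {mpoly k[m]}, (exists i, c.@[u i] != 0) /\
    forall v v' : 'I_m -> k,
      (forall c' : {mpoly k[m]}, (forall i, c'.@[u i] = 0) ->
         mmap (@dn_const k) (fun j => DualNumber (v j) (v' j)) c' = 0) ->
      c.@[v] != 0 ->
    exists b b', [/\ K b, tangent_space K b b' &
      forall P, (forall i, bieval (u i) (coords (alpha i)) P = 0) ->
      exists q : {poly k}, [/\ q.[0] = 0, q^`().[0] = 0 & forall t,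
        q.[t] = bieval (fun j => v j + t * v' j) (coords (b + t *: b')) P]].
Proof.
move=> inhI irred Kalpha.
have [pdet pdetE] := polynomial_end_det g.
have detE a : pdet.@[coords a] = end_det a := pdetE a.
have [B BE] := bieval_lift m pdet.
have nzB i : bieval (u i) (coords (alpha i)) B != 0.
  by rewrite BE detE end_det_neq0; apply/aut_ker/(subgroup_aut algK).
have [c [nzc lift]] := dominant_lift char0 inhI irred nzB.
exists c; split=> // v v' kill cv.
pose Phi : {rmorphism {mpoly k[m]} -> dual_number k} :=
  mmap (@dn_const k) (fun j => DualNumber (v j) (v' j)).
have re_Phi : dn_re (Phi c) = c.@[v].
  apply: (mpoly_rmorphism_eq (F := @dn_re k \o Phi) (G := meval v)) => [e|j] /=.
    by rewrite mmapC mevalC.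
  by rewrite mmapX mmap1U mevalXU.
have [||z [zP zB]] := lift Phi; [exact: kill|by rewrite re_Phi|].
have [b bE] := coords_of (fun j => dn_re (z j)).
have [b' b'E] := coords_of (fun j => dn_eps (z j)).
have qP P : exists q : {poly k}, (forall t,
      q.[t] = bieval (fun j => v j + t * v' j) (coords (b + t *: b')) P)
    /\ mmap Phi z P = DualNumber q.[0] q^`().[0].
  have [q [qE qD]] := bieval_dual P v v' (fun j => dn_re (z j)) (fun j => dn_eps (z j)).
  exists q; split=> [t|]; last first.
    by rewrite -qD; congr (mmap _ _ _); apply/funext => j; case: (z j).
  by rewrite qE; congr (bieval _ _ _); apply/funext => j;
    rewrite coordsD coordsZ bE b'E.
have vanish P : (forall i, bieval (u i) (coords (alpha i)) P = 0) ->
    exists q : {poly k}, [/\ q.[0] = 0, q^`().[0] = 0 & forall t,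
        q.[t] = bieval (fun j => v j + t * v' j) (coords (b + t *: b')) P].
  by move=> /zP zP0; have [q [qE]] := qP P; rewrite zP0 => -[q0 q1]; exists q.
exists b, b'; split=> //.
  apply: (in_closure_mem algK).
    move=> p pK; have [P PE] := bieval_lift m p.
    have [|q [q0 _ qE]] := vanish P; first by move=> i; rewrite PE; apply: pK.
    by rewrite -q0 qE PE scale0r addr0.
  have [q [qE qB]] := qP B; move: zB; by rewrite qB /= qE BE scale0r addr0 detE.
move=> p pK; have [P PE] := bieval_lift m p.
have [|q [_ q1 qE]] := vanish P; first by move=> i; rewrite PE; apply: pK.
rewrite (@poly_diffE _ _ _ _ _ q) // => t.
by rewrite qE PE.
Qed.

Lemma transverse_stable f : transverse K f -> K_stable K f.
Proof.
move=> trf.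
(* Over each pair lies T(h) rather than [h]: it depends on g^h only, which allows replacing [h0]
   below by a translate of [f]. *)
pose I := {p : 'Hom(g, k^o) * 'End(g) |
  [/\ chart_det f p.1 != 0, K p.2 & stab p.1 = (p.2 @: stab f)%VS]}.
pose u (i : I) := proj_coords f (sval i).1.
pose alpha (i : I) := (sval i).2.
have dimI (i : I) : \dim (stab (sval i).1) = \dim (stab f).
  by case: (svalP i) => _ /(subgroup_aut algK)/dim_img_aut dimE ->.
have inI h : conj_locus K f h -> chart_det f h != 0 -> exists i : I, (sval i).1 = h.
  move=> /(conj_locus_stab algK)[a [Ka eqS]] uh.
  by exists (exist _ (h, a) (And3 uh Ka eqS)).
have inhI : inhabited I.
  by have [i _] := inI f (conj_locus_base algK f) (chart_det_base f).
(* Polynomials in T(h) become polynomials in [h] after clearing denominators; irreducibility of g^*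
   and density of the conjugates then apply. *)
have irred (c c' : {mpoly k[_]}) : (exists i, c.@[u i] != 0) ->
    (exists i, c'.@[u i] != 0) -> exists i, (c * c').@[u i] != 0.
  move=> [i ci] [i' ci'].
  have [N [F [pF FE]]] := regular_clear_denominator c.
  have [N' [F' [pF' FE']]] := regular_clear_denominator c'.
  have [ui _ _] := svalP i; have [ui' _ _] := svalP i'.
  have Fi : F (sval i).1 != 0 by rewrite FE // mulf_neq0 ?expf_neq0.
  have Fi' : F' (sval i').1 * chart_det f (sval i').1 != 0.
    by rewrite mulf_neq0 // FE' // mulf_neq0 ?expf_neq0.
  have pFd' := polynomialM pF' (polynomial_chart_det f).
  have [h [Fh Fh']] := polynomial_irreducible pF pFd' Fi Fi'.
  have [|h' [Ch']] := conj_locus_meets char0 algK trf (polynomialM pF pFd').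
    by exists h; rewrite mulf_neq0.
  rewrite !mulf_eq0 !negb_or => /and3P[Fh1 Fh2 uh'].
  have [j jE] := inI _ Ch' uh'; exists j; rewrite mevalM mulf_neq0 // /u jE.
    by move: Fh1; rewrite FE // mulf_eq0 negb_or => /andP[].
  by move: Fh2; rewrite FE' // mulf_eq0 negb_or => /andP[].
have Kalpha i : K (alpha i) by case: (svalP i).
have [c [[i0 ci0] lift]] := subgroup_lift inhI irred Kalpha.
have [N [F [pF FE]]] := regular_clear_denominator c.
case: (svalP i0) => u0 K0 eqS0.
set h0 := (sval i0).1 in u0 eqS0; set a0 := (sval i0).2 in K0 eqS0.
have Kv := subgroupV algK K0; have autv := subgroup_aut algK Kv.
have aut0 := subgroup_aut algK K0.
have act h : stab (h \o a0^-1)%VF = (a0 @: stab h)%VS.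
  rewrite -(stab_comp h autv) -limg_comp lker0_compfV ?aut_ker //.
  by rewrite lim1g.
(* This translate of [f] has the stabilizer of [h0], hence the same T, at which [c] does not
   vanish. *)
pose f' := (f \o a0^-1)%VF.
have stabf' : stab f' = stab h0 by rewrite act.
have dimf' : \dim (stab f') = \dim (stab f) by rewrite act dim_img_aut.
have uf' : chart_det f f' != 0.
  by apply: chart_det_neq0 => //; rewrite stabf' chart_cap.
have cf' : c.@[proj_coords f f'] != 0.
  by rewrite /proj_coords (proj_along_eq uf' u0).
pose G h := chart_det f (precomp (a0^-1)%VF h) * F (precomp (a0^-1)%VF h).
exists [set h | G h != 0].
  apply: (@zariski_nbhs_polynomial _ _ G) => //.
    apply: polynomialM; apply: polynomial_comp => //.
    exact: polynomial_chart_det.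
  by rewrite /G /precomp -/f' mulf_neq0 // FE // mulf_neq0 ?expf_neq0.
move=> h; rewrite /= /G mulf_eq0 negb_or /precomp => /andP[].
set h' := (h \o a0^-1)%VF => uh'.
rewrite FE // mulf_eq0 negb_or => /andP[_ ch'].
have dimh' : \dim (stab h') = \dim (stab f).
  by apply/eqP; rewrite eqn_leq chart_dim_le //= (transverse_dim_le char0 algK).
(* Lift the point T(h') with zero tangent vector; by density, a polynomial vanishing at all [u i]
   vanishes at T(h'). *)
have [|//|b [b' [Kb _ bP]]] := lift (proj_coords f h') (fun=> 0).
  move=> c' c'I.
  have c'h' : c'.@[proj_coords f h'] = 0.
    have [N' [F' [pF' FE']]] := regular_clear_denominator c'.
    have := conj_locus_dense char0 algK trf (polynomialM pF' (polynomial_chart_det f)).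
    move=> /(_ _ h')/eqP; rewrite FE' // !mulf_eq0 expf_eq0 (negbTE uh') andbF orbF.
    move=> H; apply/eqP; apply: H => l Cl.
    have [ul|/negPn/eqP ->] := boolP (chart_det f l != 0); last by rewrite mulr0.
    have [j jE] := inI _ Cl ul.
    by rewrite FE' // -jE -/(u j) c'I mulr0 mul0r.
  by rewrite mmap_dn_const c'h' rmorph0.
have autb := subgroup_aut algK Kb.
(* For every pair of the family, T(h) kills [a y] when [y] is in g^f; this polynomial relation
   passes to [(h', b)]. *)
have b_stab : (b @: stab f <= stab h')%VS.
  apply/subvP => _ /memv_imgP[y fy ->].
  apply/(proj_along_ker _ uh' dimh')/colP => r.
  have bilE : exists P, forall l a,
      bieval (proj_coords f l) (coords a) P = mx_app (proj_along f l) (a y) r 0.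
    have pj j : exists P : {mpoly {mpoly k[\dim (chart_space f) * \dim {:g}]}[\dim {:'End(g)}]},
        forall v a, bieval v (coords a) P = coords (a y) j.
      have [p pE] := polynomial_coords_app y j.
      have [P PE] := bieval_lift (\dim (chart_space f) * \dim {:g}) p.
      by exists P => v a; rewrite PE -pE.
    have [P PE] := choice pj.
    exists (\sum_j ('X_(mxvec_index r j))%:MP * P j) => l a.
    rewrite rmorph_sum mxE; apply: eq_bigr => j _.
    by rewrite rmorphM /= bievalC mevalXU -/(bieval _ _) PE /proj_coords mxvecE mxE.
  have [P PE] := bilE.
  have [i|q [q0 _ qE]] := bP P.
    rewrite PE; have [ui _ eqSi] := svalP i.
    have /(proj_along_ker _ ui (dimI i)) -> : (alpha i) y \in stab (sval i).1.
      by rewrite eqSi memv_img.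
    by rewrite mxE.
  rewrite -PE mxE -q0 qE scale0r addr0; congr (bieval _ _ _).
  by apply/funext => j; rewrite mulr0 addr0.
have stabh' : stab h' = (b @: stab f)%VS.
  by apply/esym/eqP; rewrite eqEdim b_stab dim_img_aut //= dimh'.
exists (a0^-1 \o b)%VF; first exact: subgroupM.
apply/coadj_stabE; rewrite limg_comp -stabh' act -limg_comp.
by rewrite lker0_compVf ?aut_ker // lim1g.
Qed.

Lemma polynomial_moving_bracket x y : exists P, forall h a,
  bieval (coords h) (coords a) P = h (lie (a x) (a y)) :> k.
Proof.
have Pj j : exists P : {mpoly {mpoly k[\dim {:'Hom(g, k^o)}]}[\dim {:'End(g)}]},
    forall v a, bieval v (coords a) P
      = (vbasis {:'Hom(g, k^o)})`_j (lie (a x) (a y)) :> k.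
  have [p pE] := polynomial_bracket (app_at x) (app_at y) (vbasis {:'Hom(g, k^o)})`_j.
  have [P PE] := bieval_lift (\dim {:'Hom(g, k^o)}) p.
  by exists P => v a; rewrite PE -pE.
have [P PE] := choice Pj.
exists (\sum_j ('X_j)%:MP * P j) => h a.
rewrite rmorph_sum [in RHS](coords_vecE h) sum_lfunE; apply: eq_bigr => j _.
by rewrite rmorphM [bieval _ _ ('X_j)%:MP]bievalC mevalXU PE scale_lfunE.
Qed.

Lemma stable_transverse f : K_stable K f -> transverse K f.
Proof.
move=> [V /zariski_nbhs_basis[p [pf pV]] Vconj].
pose I := {l : 'Hom(g, k^o) * 'End(g) |
  [/\ poly_eval p l.1 != 0, K l.2 & stab l.1 = (l.2 @: stab f)%VS]}.
pose u (i : I) := coords (sval i).1.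
pose alpha (i : I) := (sval i).2.
have inI h : poly_eval p h != 0 -> exists i : I, (sval i).1 = h.
  move=> ph; have [a Ka /coadj_stabE eqS] := Vconj h (pV h ph).
  by exists (exist _ (h, a) (And3 ph Ka eqS)).
have inhI : inhabited I by have [i _] := inI f pf.
have pol c : polynomial_map (poly_eval c : 'Hom(g, k^o) -> k) by exists c.
have irred (c c' : {mpoly k[_]}) : (exists i, c.@[u i] != 0) ->
    (exists i, c'.@[u i] != 0) -> exists i, (c * c').@[u i] != 0.
  move=> [i ci] [i' ci']; have [pi' _ _] := svalP i'.
  have ci'p : poly_eval c' (sval i').1 * poly_eval p (sval i').1 != 0.
    by rewrite mulf_neq0.
  have [h [ch]] := polynomial_irreducible (pol c) (polynomialM (pol c') (pol p)) ci ci'p.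
  rewrite mulf_eq0 negb_or => /andP[ch' ph].
  by have [j jE] := inI h ph; exists j; rewrite mevalM mulf_neq0 // /u jE.
have Kalpha i : K (alpha i) by case: (svalP i).
have [c [[i0 ci0] lift]] := subgroup_lift inhI irred Kalpha.
case: (svalP i0) => p0 K0 eqS0.
set h0 := (sval i0).1 in p0 eqS0; set a0 := (sval i0).2 in K0 eqS0.
have aut0 := subgroup_aut algK K0.
(* Transversality at [h0] moves to [h0 \o a0], whose stabilizer is g^f, and from there to [f]. *)
suff tr0 : transverse K h0.
  apply: (transverse_eq_stab algK (f := (h0 \o a0)%VF)); last exact: transverse_comp.
  apply/vspaceP => x; rewrite mem_stab_comp // eqS0.
  apply/memv_imgP/idP => [[y fy /(congr1 (a0^-1)%VF)]|fx]; last by exists x.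
  by rewrite !autK // => ->.
move=> h1.
(* Every [h1] is an admissible tangent vector: [p] vanishes at finitely many points of the line
   through [h0], so a polynomial vanishing at all [u i] vanishes on the line. *)
have [|//|b [b' [Kb tb bP]]] := lift (coords h0) (coords h1).
  move=> c' c'I; have [q [qE qD]] := bieval_dual c'%:MP (coords h0) (coords h1)
    (fun=> 0 : k) (fun=> 0 : k) (n := 0).
  move: qD; rewrite mmapC => ->.
  have line0 : line_poly p h0 h1 != 0.
    by apply: contraNneq p0 => l0; rewrite -[h0]addr0 -(scale0r h1) -line_polyE l0 horner0.
  rewrite (_ : q = 0) ?deriv0 ?horner0 //.
  apply: (poly_eq_of_horner line0) => t; rewrite line_polyE => pt.
  have [j jE] := inI _ pt; rewrite qE bievalC horner0 -(c'I j) /u jE.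
  by congr (meval _ _); apply/funext => l; rewrite coordsD coordsZ.
have autb := subgroup_aut algK Kb.
(* Orders 0 and 1 of the relation h([a x, a y]) = 0 along [h0 + t *: h1] and [b + t *: b']. *)
have bracketP x y : y \in stab f ->
    h0 (lie (b x) (b y)) = 0 /\
    h1 (lie (b x) (b y)) + h0 (lie (b' x) (b y)) + h0 (lie (b x) (b' y)) = 0.
  move=> fy; have [P PE] := polynomial_moving_bracket x y.
  have [i|q [q0 q1 qE]] := bP P.
    rewrite PE; apply: stabr; have [_ _ ->] := svalP i.
    by rewrite memv_img.
  pose c1 : k := h1 (lie (b x) (b y)) + h0 (lie (b' x) (b y)) + h0 (lie (b x) (b' y)).
  pose c2 : k := h1 (lie (b' x) (b y)) + h1 (lie (b x) (b' y)) + h0 (lie (b' x) (b' y)).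
  pose r : {poly k} := (h0 (lie (b x) (b y)))%:P
    + 'X * (c1%:P + 'X * (c2%:P + 'X * (h1 (lie (b' x) (b' y)))%:P)).
  have qr : q = r.
    apply: poly_eq_of_horner_all => t; rewrite qE.
    have -> : (fun j => coords h0 j + t * coords h1 j) = coords (h0 + t *: h1).
      by apply/funext => j; rewrite coordsD coordsZ.
    rewrite PE /r !hornerE /= /c1 /c2 !(add_lfunE, scale_lfunE).
    rewrite !(lieDl, lieDr, lieZl, lieZr) !(linearD, linearZ) /= /GRing.scale /=.
    by ring.
  rewrite qr in q0 q1; split.
    by move: q0; rewrite /r hornerD hornerM hornerX mul0r addr0 hornerC.
  move: q1; rewrite /r derivD derivC add0r derivM derivX mul1r.
  by rewrite hornerD hornerM hornerX mul0r addr0 hornerD hornerM hornerX mul0r addr0 hornerC.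
have stab0 : stab h0 = (b @: stab f)%VS.
  apply/esym/eqP; rewrite eqEdim eqS0 !dim_img_aut // leqnn andbT -eqS0.
  apply/subvP => _ /memv_imgP[y fy ->]; apply: mem_stab => x.
  by have [+ _] := bracketP ((b^-1)%VF x) y fy; rewrite autVK.
(* As this [X] is a derivation, the first-order relation says that h1 + h0 X vanishes on [x, y] for
   [y] in the stabilizer of [h0]. *)
exists (b' \o b^-1)%VF; have LX := tangent_Lie_of algK Kb tb; split=> // x y.
rewrite stab0 => /memv_imgP[y0 fy ->].
have [_] := bracketP ((b^-1)%VF x) y0 fy.
rewrite add_lfunE comp_lfunE (Lie_of_derivation algK) // linearD /= !comp_lfunE.
by rewrite autVK // autK // addrA.
Qed.

End MainTheorem.

Theorem mainTheorem4 (k : closedFieldType) (char0 : [pchar k] =i pred0)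
    (g : lieAlgType k) (f : 'Hom(g, k^o)) (K : set 'End(g))
    (algK : algebraic_subgroup K) :
  bracket_span [set: g] (coadj_stab f) `&` annihilated (Lie_of K) f
    = [set 0]
  <-> K_stable K f.
Proof.
by split=> [/transverseP/(transverse_stable char0 algK)|
  /(stable_transverse char0 algK)/transverseP].
Qed.
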